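(* Let $\Bbbk$ be an algebraically closed field of characteristic $0$, let $X$ be an irreducible smooth affine algebraic variety over $\Bbbk$, $A=\Bbbk[X]$ its coordinate ring and $\mathcal{V}=\mathrm{Der}_{\Bbbk}(A)$. Let $M$ be a finite $A\mathcal{V}$-module. Then the associated representation $\rho:\mathcal{V}\to \mathrm{At}(M)$, $\rho(\eta)(m)=\eta\cdot m$, is a differential operator of order less than or equal to $\operatorname{rank}(M)^2$.
   Context: An $A\mathcal{V}$-module is a $\Bbbk$-vector space $M$ that is both an $A$-module and a module over the Lie algebra $\mathcal{V}$, such that $\eta\cdot(f\cdot m)=\eta(f)\cdot m+f\cdot(\eta\cdot m)$ for all $\eta\in\mathcal{V}$, $f\in A$, $m\in M$. It is called finite if it is finitely generated as an $A$-module. The rank is $\operatorname{rank}(M)=\dim_{\mathrm{Frac}(A)}(\mathrm{Frac}(A)\otimes_A M)$. The Atiyah algebra $\mathrm{At}(M)\subset \mathrm{End}_{\Bbbk}(M)$ is the preimage of $\mathcal{V}$ (embedded as $\eta\mapsto\eta\otimes \mathrm{id}_M$) under the symbol map $\sigma:\mathrm{Diff}^{\le 1}(M,M)\to \mathcal{V}\otimes_A\mathrm{End}_A(M)$, where $\mathrm{Diff}^{\le 1}(M,M)$ is the space of differential operators $M\to M$ of order at most one. Concretely, it consists of those $D\in\mathrm{End}_{\Bbbk}(M)$ for which there is $\eta\in\mathcal{V}$ with $D(fm)=fD(m)+\eta(f)m$ for all $f\in A$, $m\in M$. It is regarded as a left $A$-module via $(aD)(m)=a\,D(m)$; $\mathcal{V}$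 is regarded as an $A$-module in the usual way. For $A$-modules $P,Q$, a $\Bbbk$-linear map $\varphi:P\to Q$ is a differential operator of order $\le n$ if for all $f_0,\dots,f_n\in A$ one has $[\dots[[\varphi,f_0],f_1],\dots,f_n]=0$, where $[\varphi,f](x)=\varphi(fx)-f\varphi(x)$. *)

(* Defs.v *)
From HB Require Import structures.
From mathcomp Require Import all_boot all_order all_algebra.
From mathcomp Require Import generic_quotient fraction.
From mathcomp Require Import mpoly.
From mathcomp Require Import boolp classical_sets functions.

Set Implicit Arguments.
Unset Strict Implicit.
Unset Printing Implicit Defensive.

Import GRing.Theory.
Local Open Scope ring_scope.
Local Open Scope quotient_scope.
Local Open Scope classical_set_scope.

#[short(type="idomainAlgType")]
HB.structure Definition IdomainAlgebra (k : nzRingType) :=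
  {A of GRing.ComUnitAlgebra k A & GRing.IntegralDomain A}.

Section AffineVarieties.
Variables (k : fieldType) (n : nat).
Implicit Types (X Y Z : set ('I_n -> k)) (p : {mpoly k[n]}).

Definition zero_locus (S : set {mpoly k[n]}) : set ('I_n -> k) :=
  [set x | forall p, S p -> p.@[x] = 0].

Definition vanishing_ideal X : set {mpoly k[n]} :=
  [set p | forall x, X x -> p.@[x] = 0].

Definition zariski_closed X := exists S, X = zero_locus S.

Definition zariski_irreducible X :=
  X !=set0 /\
  forall Y Z, zariski_closed Y -> zariski_closed Z ->
    X = Y `|` Z -> X = Y \/ X = Z.

Definition irreducible_affine_variety X :=
  zariski_closed X /\ zariski_irreducible X.

Definition has_irreducible_chain X (d : nat) :=
  exists Z : nat -> set ('I_n -> k),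
    (forall i, (i <= d)%N -> irreducible_affine_variety (Z i) /\ Z i `<=` X) /\
    (forall i, (i < d)%N -> Z i `<` Z i.+1).

(* d is the Krull dimension of the topological space X *)
Definition has_dimension X (d : nat) :=
  has_irreducible_chain X d /\
  forall e, has_irreducible_chain X e -> (e <= d)%N.

Definition tangent_space X (x : 'I_n -> k) : set 'rV[k]_n :=
  [set v | forall p, vanishing_ideal X p ->
             \sum_(i < n) (mderiv i p).@[x] * v 0 i = 0].

(* every tangent space has dimension dim X; the existential over T only turns *)
(* the set [tangent_space X x] into an object with a dimension                *)
Definition smooth X :=
  exists d, has_dimension X d /\
    forall x, X x ->
      exists T : {vspace 'rV[k]_n},
        (forall v, v \in T <-> tangent_space X x v) /\ \dim T = d.

(* A is (isomorphic to) k[X] = k[x_1, ..., x_n] / I(X) *)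
Definition is_coordinate_ring X (A : comAlgType k) :=
  exists phi : {lrmorphism {mpoly k[n]} -> A},
    (forall a, exists p, phi p = a) /\
    (forall p, phi p = 0 <-> vanishing_ideal X p).

End AffineVarieties.

Section DifferentialOperators.
Variables (k : fieldType) (A : comAlgType k).

(* A-modules are k-vector spaces through k -> A *)
Definition k_linear (P Q : lmodType A) (phi : P -> Q) :=
  forall (c : k) (x y : P), phi (c%:A *: x + y) = c%:A *: phi x + phi y.

Definition op_comm (P Q : lmodType A) (phi : P -> Q) (f : A) : P -> Q :=
  fun x => phi (f *: x) - f *: phi x.

Definition is_diffop (n : nat) (P Q : lmodType A) (phi : P -> Q) :=
  k_linear phi /\
  forall (fs : n.+1.-tuple A) (x : P), foldl (@op_comm P Q) phi fs x = 0.

Definition finitely_generated (M : lmodType A) :=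
  exists (n : nat) (e : 'I_n -> M),
    forall m, exists c : 'I_n -> A, m = \sum_(i < n) c i *: e i.

End DifferentialOperators.

Section Derivations.
Variables (k : fieldType) (A : comAlgType k).

Definition is_derivation (eta : A -> A^o) :=
  (forall (c : k) (a b : A), eta (c *: a + b) = c *: (eta a : A) + eta b) /\
  (forall a b : A, eta (a * b) = eta a * b + a * eta b).

(* The codomain is A^o so that A -> A^o is an A-module, (a eta)(b) = a eta(b) *)
Definition der_pred : {pred A -> A^o} := fun eta => `[< is_derivation eta >].

Record Der := MkDer { der_fun :> A -> A^o; _ : der_fun \in der_pred }.

HB.instance Definition _ := [isSub for der_fun].
HB.instance Definition _ := [Choice of Der by <:].

Lemma derP (eta : Der) : is_derivation eta.
Proof. by case: eta => eta /= /asboolP. Qed.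

Lemma der_submod_closed : submod_closed der_pred.
Proof.
split=> [|a eta mu /asboolP[le me] /asboolP[lm mm]]; apply/asboolP; split.
- by move=> c x y; rewrite scaler0 addr0.
- by move=> x y; rewrite mul0r mulr0 addr0.
- move=> c x y; change (a * eta (c *: x + y) + mu (c *: x + y)
    = c *: (a * eta x + mu x : A) + (a * eta y + mu y) :> A).
  rewrite le lm; move: (eta x : A) (eta y : A) (mu x : A) (mu y : A).
  by move=> p q r s; rewrite mulrDr scalerDr scalerAr addrACA.
- move=> x y; change (a * eta (x * y) + mu (x * y)
    = (a * eta x + mu x) * y + x * (a * eta y + mu y) :> A).
  rewrite me mm; move: (eta x : A) (eta y : A) (mu x : A) (mu y : A).
  move=> p q r s; rewrite !mulrDr mulrDl addrACA.
  by rewrite mulrA [x * (a * q)]mulrCA.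
Qed.

HB.instance Definition _ :=
  GRing.SubChoice_isSubLmodule.Build A (A -> A^o) der_pred Der der_submod_closed.

Let commutator_identity (R : comPzRingType) (a b ea eb ma mb p q r s : R) :
  p * b + ma * eb + (ea * mb + a * q) - (r * b + ea * mb + (ma * eb + a * s))
  = (p - r) * b + a * (q - s).
Proof.
have regroup (x y z t : R) : x + y + (z + t) = (x + t) + (z + y).
  by rewrite addrACA [y + t]addrC addrACA.
rewrite (regroup (p * b)) (regroup (r * b)) [ea * mb + _]addrC opprD addrACA subrr addr0 opprD addrACA.
by rewrite mulrBl mulrBr.
Qed.

Lemma der_bracket_subproof (eta mu : Der) :
  (fun a => eta (mu a) - mu (eta a)) \in der_pred.
Proof.
have [[le me] [lm mm]] := (derP eta, derP mu).
have addE (nu : Der) (x y : A) : nu (x + y) = (nu x : A) + nu y :> A.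
  by have [l _] := derP nu; have := l 1 x y; rewrite !scale1r.
apply/asboolP; split=> [c a b|a b].
  rewrite le lm le lm.
  move: (eta (mu a) : A) (eta (mu b) : A) (mu (eta a) : A) (mu (eta b) : A).
  by move=> p q r s; rewrite scalerBr opprD addrACA.
rewrite me mm !addE !me !mm.
move: (eta (mu a) : A) (eta (mu b) : A) (mu (eta a) : A) (mu (eta b) : A).
move: (eta a : A) (eta b : A) (mu a : A) (mu b : A) => ea eb ma mb p q r s.
exact: commutator_identity.
Qed.

Definition der_bracket (eta mu : Der) : Der :=
  MkDer (der_bracket_subproof eta mu).

End Derivations.

Section AVModules.
Variables (k : fieldType) (A : comAlgType k) (M : lmodType A).

Record AV_module := MkAVModule {
  av_act :> Der A -> M -> M;
  av_act_linearl : forall (c : k) (eta mu : Der A) (m : M),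
    av_act (c%:A *: eta + mu) m = c%:A *: av_act eta m + av_act mu m;
  av_act_linearr : forall eta : Der A, k_linear (av_act eta);
  av_act_bracket : forall (eta mu : Der A) (m : M),
    av_act (der_bracket eta mu) m
      = av_act eta (av_act mu m) - av_act mu (av_act eta m);
  av_act_leibniz : forall (eta : Der A) (f : A) (m : M),
    av_act eta (f *: m) = (eta f : A) *: m + f *: av_act eta m }.

Definition in_atiyah (D : M -> M) :=
  k_linear D /\
  exists eta : Der A,
    forall (f : A) (m : M), D (f *: m) = f *: D m + (eta f : A) *: m.

Definition at_pred : {pred M -> M} := fun D => `[< in_atiyah D >].

Record At := MkAt { at_fun :> M -> M; _ : at_fun \in at_pred }.

HB.instance Definition _ := [isSub for at_fun].
HB.instance Definition _ := [Choice of At by <:].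

Lemma at_submod_closed : submod_closed at_pred.
Proof.
split=> [|a D E /asboolP[lD [eta hD]] /asboolP[lE [mu hE]]]; apply/asboolP.
- split=> [c x y|]; first by rewrite scaler0 addr0.
  by exists 0 => f m; rewrite scaler0 scale0r addr0.
- split=> [c x y|].
    rewrite !fctE lD lE !scalerDr !scalerA [a * _]mulrC.
    by rewrite addrACA.
  exists (a *: eta + mu) => f m; rewrite !fctE hD hE.
  rewrite !scalerDr !scalerDl !scalerA [a * f]mulrC addrACA.
  by congr (_ + (_ + _)).
Qed.

HB.instance Definition _ :=
  GRing.SubChoice_isSubLmodule.Build A (M -> M) at_pred At at_submod_closed.

Lemma rho_subproof (act : AV_module) (eta : Der A) : act eta \in at_pred.
Proof.
apply/asboolP; split; first exact: av_act_linearr.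
by exists eta => f m; rewrite av_act_leibniz addrC.
Qed.

Definition rho (act : AV_module) (eta : Der A) : At :=
  MkAt (rho_subproof act eta).

End AVModules.

Section FracTensor.
Variables (A : idomainType) (M : lmodType A).
Local Notation F := {fraction A}.
Implicit Types s t : seq (F * M).

(* Frac(A) (x)_A M is the quotient of the formal sums of pairs (x, m) by the  *)
(* relation of having the same image under every A-balanced biadditive map.   *)

Definition balanced (U : zmodType) (b : F -> M -> U) :=
  [/\ forall x y m, b (x + y) m = b x m + b y m,
      forall x m m', b x (m + m') = b x m + b x m' &
      forall x (a : A) m, b (x * tofrac a) m = b x (a *: m)].

Definition pure_sum (U : zmodType) (b : F -> M -> U) s : U :=
  \sum_(p <- s) b p.1 p.2.

Definition tensor_eq : rel (seq (F * M)) := fun s t =>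
  `[< forall (U : zmodType) (b : F -> M -> U),
        balanced b -> pure_sum b s = pure_sum b t >].

Lemma tensor_eq_refl : reflexive tensor_eq.
Proof. by move=> s; apply/asboolP. Qed.

Lemma tensor_eq_sym : ssrbool.symmetric tensor_eq.
Proof.
move=> s t.
by apply/asboolP/asboolP => h U b hb; rewrite h.
Qed.

Lemma tensor_eq_trans : transitive tensor_eq.
Proof.
move=> t s u /asboolP h1 /asboolP h2; apply/asboolP => U b hb.
by rewrite h1 // h2.
Qed.

Canonical tensor_equiv :=
  EquivRel tensor_eq tensor_eq_refl tensor_eq_sym tensor_eq_trans.

Definition frac_tensor := {eq_quot tensor_eq}.

HB.instance Definition _ := Choice.on frac_tensor.
HB.instance Definition _ := EqQuotient.on frac_tensor.

Let piP s t : reflect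
  (forall (U : zmodType) (b : F -> M -> U),
     balanced b -> pure_sum b s = pure_sum b t)
  (s == t %[mod frac_tensor]).
Proof. by rewrite piE; exact: asboolP. Qed.

Let pi_eq s t : (forall (U : zmodType) (b : F -> M -> U),
     balanced b -> pure_sum b s = pure_sum b t) ->
  \pi_frac_tensor s = \pi_frac_tensor t.
Proof. by move=> h; apply/eqP/piP. Qed.

Let reprP s (U : zmodType) (b : F -> M -> U) : balanced b ->
  pure_sum b (repr (\pi_frac_tensor s)) = pure_sum b s.
Proof. by move=> hb; have /eqP/piP -> := reprK (\pi_frac_tensor s). Qed.

Definition scale_seq (x : F) s := [seq (x * p.1, p.2) | p <- s].

Definition tensor (x : F) (m : M) : frac_tensor := \pi_frac_tensor [:: (x, m)].
Definition tzero : frac_tensor := \pi_frac_tensor [::].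
Definition tadd (u v : frac_tensor) : frac_tensor := \pi_frac_tensor (repr u ++ repr v).
Definition tscale (x : F) (u : frac_tensor) : frac_tensor :=
  \pi_frac_tensor (scale_seq x (repr u)).
Definition topp (u : frac_tensor) : frac_tensor := tscale (- 1) u.

Let sum_cat (U : zmodType) (b : F -> M -> U) s t :
  pure_sum b (s ++ t) = pure_sum b s + pure_sum b t.
Proof. exact: big_cat. Qed.

Let sum_scale (U : zmodType) (b : F -> M -> U) x s :
  pure_sum b (scale_seq x s) = pure_sum (fun y => b (x * y)) s.
Proof. by rewrite /pure_sum big_map. Qed.

Let sum_scaleD (U : zmodType) (b : F -> M -> U) x y s : balanced b ->
  pure_sum (fun z => b ((x + y) * z)) s =
  pure_sum (fun z => b (x * z)) s + pure_sum (fun z => b (y * z)) s.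
Proof.
by case=> bD _ _; rewrite -big_split; apply: eq_bigr => p _; rewrite mulrDl bD.
Qed.

Let balanced_scale (U : zmodType) (b : F -> M -> U) x :
  balanced b -> balanced (fun y => b (x * y)).
Proof.
case=> bDl bDr bA; split=> [y z m|y m m'|y a m].
- by rewrite mulrDr bDl.
- exact: bDr.
- by rewrite mulrA bA.
Qed.

Let tensorW (P : frac_tensor -> Prop) :
  (forall s, P (\pi_frac_tensor s)) -> forall u, P u.
Proof. by move=> h u; rewrite -[u]reprK. Qed.

Let taddE s t : tadd (\pi_frac_tensor s) (\pi_frac_tensor t) = \pi_frac_tensor (s ++ t).
Proof. by apply: pi_eq => U b hb; rewrite !sum_cat !reprP. Qed.

Let tscaleE x s : tscale x (\pi_frac_tensor s) = \pi_frac_tensor (scale_seq x s).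
Proof.
by apply: pi_eq => U b hb; rewrite !sum_scale reprP //; exact: balanced_scale.
Qed.

Lemma taddA : associative tadd.
Proof.
elim/tensorW=> s; elim/tensorW=> t; elim/tensorW=> u.
by rewrite !taddE catA.
Qed.

Lemma taddC : commutative tadd.
Proof.
elim/tensorW=> s; elim/tensorW=> t; rewrite !taddE.
by apply: pi_eq => U b hb; rewrite !sum_cat addrC.
Qed.

Lemma tadd0 : left_id tzero tadd.
Proof. by elim/tensorW=> s; rewrite taddE. Qed.

Lemma taddN : left_inverse tzero topp tadd.
Proof.
elim/tensorW=> s; rewrite /topp tscaleE taddE; apply: pi_eq => U b hb.
rewrite sum_cat sum_scale [RHS]big_nil.
have -> : pure_sum b s = pure_sum (fun z => b (1 * z)) s.
  by apply: eq_bigr => p _; rewrite mul1r.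
rewrite -sum_scaleD // addNr; case: hb => bD _ _.
apply: big1 => p _; rewrite mul0r.
by apply: (addrI (b 0 p.2)); rewrite -bD !addr0.
Qed.

HB.instance Definition _ :=
  GRing.isZmodule.Build frac_tensor taddA taddC tadd0 taddN.

Lemma tscaleA x y u : tscale x (tscale y u) = tscale (x * y) u.
Proof.
elim/tensorW: u => s; rewrite !tscaleE; congr (\pi_frac_tensor _).
by rewrite /scale_seq -map_comp; apply: eq_map => p /=; rewrite mulrA.
Qed.

Lemma tscale1 : left_id 1 tscale.
Proof.
elim/tensorW=> s; rewrite tscaleE; congr (\pi_frac_tensor _).
by rewrite -[RHS]map_id; apply: eq_map => -[x m] /=; rewrite mul1r.
Qed.

Lemma tscaleDr : right_distributive tscale +%R.
Proof.
move=> x; elim/tensorW=> s; elim/tensorW=> t.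
change (tscale x (tadd (\pi_frac_tensor s) (\pi_frac_tensor t)) =
  tadd (tscale x (\pi_frac_tensor s)) (tscale x (\pi_frac_tensor t))).
by rewrite taddE !tscaleE taddE /scale_seq map_cat.
Qed.

Lemma tscaleDl u : {morph tscale^~ u : x y / x + y}.
Proof.
elim/tensorW: u => s x y; rewrite !tscaleE [RHS]taddE.
apply: pi_eq => U b hb; rewrite sum_cat !sum_scale; exact: sum_scaleD.
Qed.

HB.instance Definition _ := GRing.Zmodule_isLmodule.Build F frac_tensor
  tscaleA tscale1 tscaleDr tscaleDl.

Lemma tensor_balanced : balanced tensor.
Proof.
split=> [x y m|x m m'|x a m]; rewrite /tensor ?[_ + _ in RHS]taddE;
  apply: pi_eq => U b [bDl bDr bA].
- by rewrite sum_cat /pure_sum !big_seq1 bDl.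
- by rewrite sum_cat /pure_sum !big_seq1 bDr.
- by rewrite /pure_sum !big_seq1 bA.
Qed.

Lemma tensor_scale x y m : x *: tensor y m = tensor (x * y) m.
Proof. exact: tscaleE. Qed.

Lemma tensor_generates (u : frac_tensor) :
  exists s, u = \sum_(p <- s) tensor p.1 p.2.
Proof.
elim/tensorW: u => s; exists s; elim: s => [|[x m] s IHs]; first by rewrite big_nil.
by rewrite big_cons -IHs [RHS]taddE.
Qed.

Lemma tensor_universal (U : zmodType) (b : F -> M -> U) : balanced b ->
  exists g : {additive frac_tensor -> U}, forall x m, g (tensor x m) = b x m.
Proof.
move=> hb; pose g (u : frac_tensor) := pure_sum b (repr u).
have gD : zmod_morphism g.
  have gA u v : g (u + v) = g u + g v.
    elim/tensorW: u => s; elim/tensorW: v => t.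
    by rewrite [_ + _ in LHS]taddE /g !reprP // sum_cat.
  by move=> u v; rewrite -[in RHS](subrK v u) [in RHS]gA addrK.
pose gm := GRing.isZmodMorphism.Build _ _ g gD.
pose ga : {additive frac_tensor -> U} := HB.pack g gm.
by exists ga => x m; rewrite /= /g reprP // /pure_sum big_seq1.
Qed.

End FracTensor.

Section Rank.

Definition is_basis (F : fieldType) (V : lmodType F) (n : nat)
    (e : 'I_n -> V) :=
  forall v, exists! c : 'rV[F]_n, v = \sum_(i < n) c 0 i *: e i.

(* junk value 0 if V is not finite-dimensional *)
Definition dimension (F : fieldType) (V : lmodType F) : nat :=
  xget 0%N [set n | exists e : 'I_n -> V, is_basis e].

Definition rank (A : idomainType) (M : lmodType A) : nat :=
  dimension (frac_tensor M).

End Rank.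

(* Main.v *)
Require Import Defs.
From HB Require Import structures.
From mathcomp Require Import all_boot all_order all_algebra.
From mathcomp Require Import generic_quotient fraction ring zify.
From mathcomp Require Import mpoly.
From mathcomp Require Import boolp classical_sets functions.

Set Implicit Arguments.
Unset Strict Implicit.
Unset Printing Implicit Defensive.

Import GRing.Theory.
Local Open Scope ring_scope.
Local Open Scope quotient_scope.

(* Since the symbol kills [rho (f eta) - f rho eta], iterated commutators of
   [rho] with functions are [A]-linear, so on the torsion-free module [M] they
   can be tested at the points [x] where [M] is locally free of rank [r]. With
   [m] the maximal ideal of [x], the Lie algebra [m Der(A)] acts linearly on the
   fibre, by some [sigma] with values in r x r matrices, and the theorem says
   that [sigma] kills [m^(r^2 + 1) Der(A)]. Put [W_s = sigma(m^s Der(A))].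
   - [W_s = 0] for large [s]: the kernel of [sigma] has finite codimension, so by
     Grabowski's trick it contains [f Der(A)] for some [f != 0]; the ideal of
     such [f], saturated at [m], is stable under [Der(A)], hence is all of [A].
   - Smoothness gives an Euler field [E = sum_i t_i d/dt_i] at [x], which acts on
     [m^s Der(A) / m^(s+1) Der(A)] as [s - 1]. Brackets with [m^2 Der(A)] then
     show that [W_s = W_(s+1)] implies [W_(s+1) = W_(s+2)] for [s > 2], with
     substitutes for [s = 1, 2]. So [W_(r^2 + 1) != 0] would force a strictly
     decreasing chain of [r^2 + 1] nonzero subspaces of the r x r matrices.
   That [Der(A)] preserves no ideal of [A] except [0] and [A] follows from the
   Nullstellensatz, the Euler fields and Krull's intersection theorem; it also
   implies that [M] is torsion-free. *)

(** * Zariski's lemma *)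

(** Constants are not built in: in the applications to algebras [P] contains the image of a base
    ring, and this is then the subalgebra generated over it. *)
Inductive ring_gen (R : pzRingType) (P : R -> Prop) : R -> Prop :=
| ring_gen_in x : P x -> ring_gen P x
| ring_genD x y : ring_gen P x -> ring_gen P y -> ring_gen P (x + y)
| ring_genM x y : ring_gen P x -> ring_gen P y -> ring_gen P (x * y).

Lemma ring_gen_sub (R : pzRingType) (P Q : R -> Prop) :
  (forall x, P x -> Q x) -> forall x, ring_gen P x -> ring_gen Q x.
Proof.
move=> PQ x; elim=> {x} [x /PQ|x y _ Gx _ Gy|x y _ Gx _ Gy].
- exact: ring_gen_in.
- exact: ring_genD.
- exact: ring_genM.
Qed.

(** If [p] has degree [d] and leading coefficient [l], multiplying [p(z) = 0] by [l^(d-1)] turns it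
    into a monic equation for [l z]. *)
Lemma integral_lead_coefM (R : idomainType) (K : comNzRingType)
    (i : {rmorphism R -> K}) (p : {poly R}) (z : K) :
  injective i -> p != 0 -> root (map_poly i p) z ->
  integralOver i (i (lead_coef p) * z).
Proof.
move=> inj_i nz_p /eqP pz0; set l := lead_coef p.
have [n sz_p] : exists n, size p = n.+2.
  case sz_p: (size p) => [|[|n]]; last by exists n.
    by move/eqP: sz_p; rewrite size_poly_eq0 (negPf nz_p).
  have [c nz_c Dp] := size_poly1P p (introT eqP sz_p).
  move: pz0; rewrite Dp map_polyC hornerC -(rmorph0 i) => /inj_i c0.
  by rewrite c0 eqxx in nz_c.
have lE : l = p`_n.+1 by rewrite /l lead_coefE sz_p.
pose q := 'X^(n.+1) + \poly_(j < n.+1) (l ^+ (n - j) * p`_j).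
exists q.
  rewrite monicE lead_coefDl ?lead_coefXn // size_polyXn ltnS.
  exact: size_poly.
rewrite /root rmorphD /= map_polyXn hornerD hornerXn.
rewrite (@horner_coef_wide _ n.+1); last first.
  by rewrite (leq_trans (size_poly _ _)) // size_poly.
have -> : (i l * z) ^+ n.+1 +
    \sum_(j < n.+1) (map_poly i (\poly_(j0 < n.+1) (l ^+ (n - j0) * p`_j0)))`_j
      * (i l * z) ^+ j = i l ^+ n * (map_poly i p).[z].
  rewrite (@horner_coef_wide _ n.+2); last by rewrite -sz_p size_poly.
  rewrite [in RHS]big_ord_recr /= mulrDr addrC; congr (_ + _); last first.
    by rewrite coef_map /= -lE exprMn exprSr mulrA.
  rewrite mulr_sumr; apply: eq_bigr => j _.
  rewrite !coef_map /= coef_poly ltn_ord rmorphM rmorphXn exprMn.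
  have le_jn : (j <= n)%N by rewrite -ltnS.
  have -> : i l ^+ n = i l ^+ (n - j) * i l ^+ j by rewrite -exprD subnK.
  by ring.
by rewrite pz0 mulr0.
Qed.

Lemma integral_common_multiplier (R : idomainType) (K : comNzRingType)
    (i : {rmorphism R -> K}) (s : seq K) : injective i ->
  (forall z, z \in s -> exists2 p, p != 0 & root (map_poly i p) z) ->
  exists2 f, f != 0 & forall z, z \in s -> integralOver i (i f * z).
Proof.
move=> inj_i; elim: s => [|z s IHs] alg_s; first by exists 1; rewrite ?oner_neq0.
have [|f nz_f int_f] := IHs; first by move=> y sy; apply: alg_s; rewrite inE sy orbT.
have [p nz_p pz0] := alg_s z (mem_head _ _).
exists (lead_coef p * f); first by rewrite mulf_neq0 // lead_coef_eq0.
move=> y; rewrite inE rmorphM => /predU1P[-> | s_y].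
  rewrite mulrAC mulrC; apply: integral_mul (integral_id i f) _.
  exact: integral_lead_coefM.
by rewrite -mulrA; apply: integral_mul (integral_id i _) (int_f y s_y).
Qed.

Lemma integral_ring_gen (R K : comNzRingType) (i : {rmorphism R -> K})
    (P : K -> Prop) (f : R) (y : K) :
  (forall z, P z -> integralOver i (i f * z)) ->
  ring_gen P y -> exists N, integralOver i (i (f ^+ N) * y).
Proof.
move=> intP; elim=> {y} [y /intP int_y|x y _ [N1 int1] _ [N2 int2]|x y _ [N1 int1] _ [N2 int2]].
- by exists 1%N; rewrite expr1.
- exists (N1 + N2)%N; rewrite exprD rmorphM mulrDr; apply: integral_add.
    by rewrite mulrAC mulrC; apply: integral_mul (integral_id _ _) int1.
  by rewrite -mulrA; apply: integral_mul (integral_id _ _) int2.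
- exists (N1 + N2)%N; rewrite exprD rmorphM mulrACA; exact: integral_mul.
Qed.

(** Think of [v] as [1/w]: clearing denominators in a monic equation of degree [m] for [c/w] leaves
    [c^m] plus terms divisible by [w]. *)
Lemma integral_ratio_dvd (R K : comNzRingType) (i : {rmorphism R -> K})
    (c w : R) (v : K) : injective i -> i w * v = 1 ->
  integralOver i (i c * v) -> exists m h, c ^+ m = w * h.
Proof.
move=> inj_i wv1 [p mon_p /eqP pcv0]; pose m := (size p).-1.
have sz_p : size p = m.+1 by rewrite polySpred // monic_neq0.
exists m, (- \sum_(j < m) p`_j * c ^+ j * w ^+ (m - j.+1)); apply: inj_i.
move: pcv0 => /(congr1 (fun t => i w ^+ m * t)); rewrite mulr0.
rewrite (@horner_coef_wide _ m.+1); last by rewrite -sz_p size_poly.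
have wvX j : i w ^+ j * v ^+ j = 1 by rewrite -exprMn wv1 expr1n.
rewrite big_ord_recr /= coef_map /=.
have -> : p`_m = 1 by move/monicP: mon_p; rewrite lead_coefE sz_p.
rewrite rmorph1 mul1r mulrDr exprMn [i w ^+ m * (_ * _)]mulrCA wvX mulr1.
move/eqP; rewrite addrC addr_eq0 => /eqP; rewrite rmorphXn => ->.
rewrite mulrN rmorphN rmorphM rmorph_sum; congr (- _); rewrite !mulr_sumr.
apply: eq_bigr => j _; rewrite coef_map /= !rmorphM !rmorphXn exprMn.
have {1}-> : m = ((m - j.+1).+1 + j)%N by rewrite addSnnS subnK.
rewrite exprD exprS.
transitivity (i w * (i p`_j * i c ^+ j * i w ^+ (m - j.+1)) * (i w ^+ j * v ^+ j)); first by ring.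
by rewrite wvX mulr1.
Qed.

(* If [a] in [s] were transcendental over [R], all of [K]
   would be integral over a localisation [R[a][1/bf]], although [1 + a f] has no
   inverse there. *)
Lemma zariski_algebraic (K : comNzRingType)
    (K_inv : forall y : K, y != 0 -> exists v, y * v = 1) :
  forall (N : nat) (s : seq K) (R : idomainType) (i : {rmorphism R -> K}),
  (size s <= N)%N -> injective i ->
  (forall y, exists2 b, b != 0 &
     ring_gen (fun z => (exists c, z = i c) \/ z \in s) (i b * y)) ->
  forall a, a \in s -> exists2 p : {poly R}, p != 0 & root (map_poly i p) a.
Proof.
elim=> [|N IHN] s R i sz_s inj_i gen_s a s_a.
  by move: sz_s s_a; rewrite leqn0 => /nilP ->.
apply: contrapT => trans_a.
pose i' : {rmorphism {poly R} -> K} := horner_eval a \o map_poly i.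
have i'E p : i' p = (map_poly i p).[a] by [].
have inj_i' : injective i'.
  apply: raddf_inj => p i'p0; apply/eqP/negP => /negP nz_p.
  by apply: trans_a; exists p => //; apply/eqP.
have gen_s' y : ring_gen (fun z => (exists c, z = i c) \/ z \in s) y ->
    ring_gen (fun z => (exists c, z = i' c) \/ z \in rem a s) y.
  apply: ring_gen_sub => z [[c ->] | s_z].
    by left; exists c%:P; rewrite i'E map_polyC hornerC.
  have := perm_mem (perm_to_rem s_a) z; rewrite s_z inE => /esym/predU1P[->|]; last by right.
  by left; exists 'X; rewrite i'E map_polyX hornerX.
have [||f nz_f int_f] := @integral_common_multiplier _ _ i' (rem a s).
- by [].
- apply: IHN => //.
    by rewrite size_rem // -ltnS (leq_trans _ sz_s) //; case: (s) s_a.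
  move=> y; have [b nz_b /gen_s' gen_y] := gen_s y.
  by exists b%:P; rewrite ?polyC_eq0 // i'E map_polyC hornerC.
have sz_w : (1 < size (1 + 'X * f)%R)%N.
  have szXf : (1 < size ('X * f)%R)%N.
    by rewrite mulrC size_mulX // ltnS lt0n size_poly_eq0.
  by rewrite addrC size_polyDl ?size_poly1.
set w := 1 + 'X * f in sz_w.
have nz_w : w != 0 by rewrite -size_poly_gt0 ltnW.
have [v wv1] : exists v, i' w * v = 1.
  by apply: K_inv; rewrite -(rmorph0 i') (inj_eq inj_i').
have [b nz_b /gen_s' gen_v] := gen_s v.
have [N1] : exists N, integralOver i' (i' (f ^+ N) * (i b * v)).
  apply: integral_ring_gen gen_v => z [[c ->]|]; last exact: int_f.
  by rewrite -rmorphM; apply: integral_id.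
have -> : i b = i' b%:P by rewrite i'E map_polyC hornerC.
rewrite mulrA -rmorphM => /(integral_ratio_dvd inj_i' wv1)[m [h fb_w]].
(* Modulo [w] one has [- X f = 1]. Multiplying [(f^N1 b)^m = w h] by [(- X)^(N1 m)] therefore puts
   the nonzero constant [b^m] into the ideal of [w], against degrees. *)
have [h' Xf_w] : exists h', (- ('X * f)) ^+ (N1 * m) = 1 + w * h'.
  elim: (N1 * m)%N => [|e [h' IHe]]; first by exists 0; rewrite mulr0 addr0.
  exists (- 1 - 'X * f * h'); rewrite exprS IHe /w; ring.
clearbody w.
have : (b ^+ m)%:P = w * ((- 'X) ^+ (N1 * m) * h - (b ^+ m)%:P * h').
  have eq1 : (- 'X) ^+ (N1 * m) * (f ^+ N1 * b%:P) ^+ m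
      = (1 + w * h') * (b ^+ m)%:P.
    rewrite -Xf_w -mulNr !exprMn -exprM rmorphXn; ring.
  transitivity ((1 + w * h') * (b ^+ m)%:P - w * h' * (b ^+ m)%:P); first by ring.
  by rewrite -eq1 fb_w; ring.
set u := (_ - _); have [->|nz_u] := eqVneq u 0.
  by rewrite mulr0 => /eqP; rewrite polyC_eq0 expf_eq0 (negPf nz_b) andbF.
move/(congr1 (fun t : {poly R} => size t)); rewrite size_mul // size_polyC expf_neq0 //=.
move: sz_w nz_u; rewrite -size_poly_gt0.
by case: (size w) => [|[|x]] //; case: (size u) => // y _ _; rewrite addSn addnS.
Qed.

(** * The Nullstellensatz *)

Definition is_ideal (R : pzRingType) (I : R -> Prop) :=
  [/\ I 0, forall x y, I x -> I y -> I (x + y) & forall a x, I x -> I (a * x)].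

Lemma kernel_ideal (R S : pzRingType) (f : {rmorphism R -> S}) :
  is_ideal (fun x => f x = 0).
Proof.
split=> [|x y fx0 fy0|a x fx0]; first exact: rmorph0.
  by rewrite rmorphD fx0 fy0 addr0.
by rewrite rmorphM fx0 mulr0.
Qed.

Lemma maximal_ideal (R : comNzRingType) (J : R -> Prop) :
  is_ideal J -> ~ J 1 -> exists I : R -> Prop,
    [/\ is_ideal I, forall x, J x -> I x, ~ I 1 &
        forall x, ~ I x -> exists y, I (x * y - 1)].
Proof.
move=> idJ J1.
pose proper (I : set R) := [/\ is_ideal I, (J `<=` I)%classic & ~ I 1].
have [F chainP totF|I [I0 maxI]] := @Zorn_bigcup R (fun I => I = set0 \/ proper I).
  have [[I0 FI0 prI0]|noI] := pselect (exists2 I0, F I0 & proper I0); last first.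
    left; apply/seteqP; split=> // x [I FI Ix].
    case: (chainP I FI) => [I_0|prI]; first by rewrite I_0 in Ix.
    by case: noI; exists I.
  right; split=> [|x Jx|[I FI I1]].
  - split=> [|x y [I FI Ix] [I' FI' Iy]|a x [I FI Ix]].
    + by exists I0 => //; case: prI0 => [[]].
    + have [II'|I'I] := totF _ _ FI FI'.
        exists I' => //; case: (chainP I' FI') => [I_0|[[_ ID _] _ _]].
          by rewrite I_0 in Iy.
        exact/ID/Iy/II'.
      exists I => //; case: (chainP I FI) => [I_0|[[_ ID _] _ _]].
        by rewrite I_0 in Ix.
      exact/ID/I'I.
    + exists I => //; case: (chainP I FI) => [I_0|[[_ _ IM] _ _]].
        by rewrite I_0 in Ix.
      exact: IM.
  - by exists I0 => //; case: prI0 => _ JI _; exact: JI.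
  - case: (chainP I FI) => [I_0|[_ _]]; last exact.
    by rewrite I_0 in I1.
have {I0} [idI JI I1] : proper I.
  case: I0 => // I_0; case: (maxI J); last by right; split.
  by rewrite I_0; split=> // /(_ 0); case: idJ => J0 _ _ /(_ J0).
exists I; split=> // x Ix; have [I0 ID IM] := idI.
pose I' : set R := fun z => exists y a, I y /\ z = y + a * x.
have I'I : (I `<=` I')%classic by move=> y Iy; exists y, 0; rewrite mul0r addr0.
have [y [a [Iy D1]]] : I' 1.
  apply: contrapT => I'1; case: (maxI I').
    split=> // /(_ x) I'x; apply/Ix/I'x.
    by exists 0, 1; rewrite mul1r add0r.
  right; split=> //; last by move=> z /JI/I'I.
  split=> [|u v [y [a [Iy ->]]] [y' [a' [Iy' ->]]]|b u [y [a [Iy ->]]]].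
  - exact: I'I.
  - exists (y + y'), (a + a'); split; first exact: ID.
    by rewrite mulrDl addrACA.
  - exists (b * y), (b * a); split; first exact: IM.
    by rewrite mulrDr mulrA.
exists a; rewrite D1 mulrC opprD addrCA subrr addr0.
by rewrite -mulN1r; apply: IM.
Qed.

Lemma ideal_quotient (R : comNzRingType) (I : R -> Prop) :
  is_ideal I -> ~ I 1 ->
  exists (K : comNzRingType) (pi : {rmorphism R -> K}),
    (forall y, exists x, y = pi x) /\ forall x, pi x = 0 <-> I x.
Proof.
move=> [I0 ID IM] I1; pose S : R -> bool := fun x => `[< I x >].
have clS : idealr_closed S.
  split; [exact/asboolP | by apply/negP => /asboolP |].
  move=> a x y /asboolP Ix /asboolP Iy; apply/asboolP/ID => //; exact: IM.
pose mixS := isIdealr.Build R S clS.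
pose J : idealr R := HB.pack S mixS.
exists {ideal_quot J}, \pi_{ideal_quot J}; split=> [y|x].
  by exists (repr y); apply: esym (reprK y).
split=> [/eqP|Ix].
  by rewrite -(rmorph0 \pi_{ideal_quot J}) -Quotient.idealrBE subr0 => /asboolP.
apply/eqP; rewrite -(rmorph0 \pi_{ideal_quot J}) -Quotient.idealrBE subr0.
exact/asboolP.
Qed.

Lemma closed_field_root (k : closedFieldType) (K : comNzRingType)
    (i : {rmorphism k -> K}) (a : K) (p : {poly k}) :
  (forall x y : K, x * y = 0 -> x = 0 \/ y = 0) ->
  p != 0 -> root (map_poly i p) a -> exists c, a = i c.
Proof.
move=> K_dom nz_p; have [r ->] := closed_field_poly_normal p.
rewrite rootE map_polyZ hornerZ.
have [v lv1] : exists v, i (lead_coef p) * v = 1.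
  by exists (i (lead_coef p)^-1); rewrite -rmorphM mulfV ?rmorph1 ?lead_coef_eq0.
move/eqP/(congr1 ( *%R v)); rewrite mulr0 mulrA [v * _]mulrC lv1 mul1r.
elim: r => [|z r IHr].
  by rewrite big_nil rmorph1 hornerC => /eqP; rewrite oner_eq0.
rewrite big_cons rmorphM hornerM rmorphB /= map_polyX map_polyC hornerXsubC => prod0.
have [az|] := K_dom _ _ prod0; last exact: IHr.
by exists z; apply/eqP; rewrite -subr_eq0 az.
Qed.

(** The residue ring at a maximal ideal containing [J] is a field generated by finitely many
    elements over [k]. By Zariski's lemma these are algebraic over [k], so the residue field is [k]
    itself. *)
Lemma nullstellensatz (k : closedFieldType) (A : comNzRingType)
    (i : {rmorphism k -> A}) (s : seq A) (J : A -> Prop) :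
  (forall a, ring_gen (fun z => (exists c, z = i c) \/ z \in s) a) ->
  is_ideal J -> ~ J 1 ->
  exists ev : {rmorphism A -> k},
    (forall c, ev (i c) = c) /\ (forall a, J a -> ev a = 0).
Proof.
move=> gen_s idJ J1; have [I [idI JI I1 maxI]] := maximal_ideal idJ J1.
have [K [pi [pi_surj pi0]]] := ideal_quotient idI I1.
have K_inv (y : K) : y != 0 -> exists v, y * v = 1.
  have [x ->] := pi_surj y => nz_x.
  have [|u] := maxI x; first by move/pi0/eqP; apply/negP.
  move/pi0; rewrite rmorphB rmorphM rmorph1 => /eqP; rewrite subr_eq0 => /eqP.
  by exists (pi u).
pose j : {rmorphism k -> K} := pi \o i.
have inj_j : injective j by exact: fmorph_inj.
have gen_pi a : ring_gen (fun z => (exists c, z = j c) \/ z \in map pi s) (pi a).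
  elim: (gen_s a) => {a} [a [[c ->]|s_a]|x y _ Gx _ Gy|x y _ Gx _ Gy].
  - by apply: ring_gen_in; left; exists c.
  - by apply: ring_gen_in; right; apply: map_f.
  - by rewrite rmorphD; apply: ring_genD.
  - by rewrite rmorphM; apply: ring_genM.
have j_surj_s z : z \in map pi s -> exists c, z = j c.
  move=> s_z; have [|y|p nz_p pz0] := @zariski_algebraic K K_inv _ (map pi s) k j (leqnn _) _ _ z s_z.
  - exact: inj_j.
  - exists 1; first exact: oner_neq0.
    by rewrite rmorph1 mul1r; have [a ->] := pi_surj y.
  - apply: closed_field_root pz0 => // x y xy0.
    have [->|/K_inv[v xv1]] := eqVneq x 0; [by left | right].
    by rewrite -[y]mul1r -xv1 mulrAC xy0 mul0r.
have j_surj a : exists c, pi a = j c.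
  elim: (gen_pi a) => {a} [z [//|]|x y _ [c ->] _ [d ->]|x y _ [c ->] _ [d ->]].
  - exact: j_surj_s.
  - by exists (c + d); rewrite rmorphD.
  - by exists (c * d); rewrite rmorphM.
have [ev evE] := choice j_surj.
have evB : zmod_morphism ev.
  by move=> x y; apply: inj_j; rewrite rmorphB -!evE rmorphB.
have evM : monoid_morphism ev.
  split=> [|x y]; apply: inj_j; first by rewrite -evE !rmorph1.
  by rewrite rmorphM -!evE rmorphM.
pose mB := GRing.isZmodMorphism.Build _ _ ev evB.
pose mM := GRing.isMonoidMorphism.Build _ _ ev evM.
pose ev' : {rmorphism A -> k} := HB.pack ev mB mM.
exists ev'; split=> [c|a Ja]; apply: inj_j; rewrite -evE //.
by rewrite rmorph0; apply/pi0/JI.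
Qed.

(** * Hilbert's basis theorem and Krull's intersection theorem *)

Inductive sums (V : nmodType) (P : V -> Prop) : V -> Prop :=
| sums0 : sums P 0
| sums_in x : P x -> sums P x
| sumsD x y : sums P x -> sums P y -> sums P (x + y).

Lemma sums_sub (V : nmodType) (P Q : V -> Prop) :
  (forall x, P x -> Q x) -> forall x, sums P x -> sums Q x.
Proof.
move=> PQ x; elim=> [|{}x /PQ|{}x y _ Px _ Py]; first exact: sums0.
  exact: sums_in.
exact: sumsD.
Qed.

Lemma sums_big (V : nmodType) (P : V -> Prop) (I : finType) (F : I -> V) :
  (forall i, sums P (F i)) -> sums P (\sum_i F i).
Proof. by move=> PF; elim/big_ind: _ => //; [exact: sums0 | exact: sumsD]. Qed.

Definition ideal_gen (R : pzRingType) (P : R -> Prop) : R -> Prop :=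
  sums (fun y => exists a x, P x /\ y = a * x).

Lemma ideal_gen_ideal (R : pzRingType) (P : R -> Prop) : is_ideal (ideal_gen P).
Proof.
split=> [|x y|a x]; [exact: sums0 | exact: sumsD |].
elim=> [|{}x [b [y [Py ->]]]|{}x y _ IHx _ IHy]; first by rewrite mulr0; apply: sums0.
  by apply: sums_in; exists (a * b), y; rewrite mulrA.
by rewrite mulrDr; apply: sumsD.
Qed.

Lemma ideal_gen_in (R : pzRingType) (P : R -> Prop) x : P x -> ideal_gen P x.
Proof. by move=> Px; apply: sums_in; exists 1, x; rewrite mul1r. Qed.

Lemma ideal_gen_min (R : pzRingType) (P I : R -> Prop) :
  is_ideal I -> (forall x, P x -> I x) -> forall x, ideal_gen P x -> I x.
Proof.
move=> [I0 ID IM] PI x; elim=> // [{}x [a [y [/PI Iy ->]]]|]; last by move=> *; apply: ID.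
exact: IM.
Qed.

Lemma idealB (R : pzRingType) (I : R -> Prop) x y :
  is_ideal I -> I x -> I y -> I (x - y).
Proof. by case=> _ ID IM Ix Iy; apply: ID => //; rewrite -mulN1r; apply: IM. Qed.

(** A form of the ascending chain condition that applies directly to a sequence of elements: leading
    coefficients in the basis theorem, the [f 'X^n] in Krull's theorem. *)
Definition noetherian (R : pzRingType) :=
  forall a : nat -> R, exists m,
    ideal_gen (fun x => exists2 j, (j < m)%N & x = a j) (a m).

Lemma field_noetherian (k : fieldType) : noetherian k.
Proof.
move=> a; have [a0|nz_a0] := eqVneq (a 0) 0.
  by exists 0; rewrite a0; apply: sums0.
exists 1; apply: sums_in; exists (a 1 / a 0), (a 0).
by split; [exists 0 | rewrite mulfVK].
Qed.

(** From an ideal [I] that is not finitely generated, pick [g n] of least degree outside the ideal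
    of its predecessors. Once the leading coefficient of some [g m] is a combination of earlier
    ones, the same combination of the [g j], shifted by powers of ['X], can be subtracted; this
    lowers the degree of [g m] but leaves it outside that ideal. *)
Lemma hilbert_basis (R : comNzRingType) : noetherian R -> noetherian {poly R}.
Proof.
move=> noeR f; apply: contrapT => nof.
pose I := ideal_gen (fun x => exists j, x = f j).
have idI : is_ideal I := ideal_gen_ideal _.
pose sp (s : seq {poly R}) := ideal_gen (fun x => x \in s).
have I_big x : I x -> exists m, forall n, (m <= n)%N ->
    ideal_gen (fun x => exists2 j, (j < n)%N & x = f j) x.
  elim=> [|{}x [a [y [[j ->] ->]]]|{}x y _ [m1 IH1] _ [m2 IH2]].
  - by exists 0 => n _; apply: sums0.
  - exists j.+1 => n lt_jn; apply: sums_in; exists a, (f j); split=> //.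
    by exists j.
  - exists (maxn m1 m2) => n; rewrite geq_max => /andP[le1 le2].
    by apply: sumsD; [apply: IH1 | apply: IH2].
have next (s : seq {poly R}) : (forall x, x \in s -> I x) ->
    exists g, [/\ I g, ~ sp s g & forall h, I h -> ~ sp s h -> (size g <= size h)%N].
  move=> sI.
  (* Finitely many elements of [I] already lie in the ideal of [f 0, ..., f (m - 1)], so [f m] is a
     candidate outside the ideal of [s]. *)
  have [m Im] : exists m, forall x, x \in s ->
      ideal_gen (fun x => exists2 j, (j < m)%N & x = f j) x.
    elim: s sI => [|x s IHs] sI; first by exists 0.
    have [|m1 I1] := IHs; first by move=> y sy; apply: sI; rewrite inE sy orbT.
    have [m2 I2] := I_big x (sI x (mem_head _ _)).
    exists (maxn m1 m2) => y; rewrite inE => /predU1P[->|/I1]; first exact: I2 (leq_maxr _ _).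
    apply: ideal_gen_min => [|z [j lt_jm ->]]; first exact: ideal_gen_ideal.
    by apply: ideal_gen_in; exists j; rewrite // (leq_trans lt_jm) // leq_maxl.
  pose Q n := `[< exists g, [/\ I g, ~ sp s g & size g = n] >].
  have exQ : exists n, Q n.
    exists (size (f m)); apply/asboolP; exists (f m); split=> //.
      by apply: ideal_gen_in; exists m.
    move=> sfm; apply: nof; exists m.
    by apply: ideal_gen_min sfm => //; apply: ideal_gen_ideal.
  case: (ex_minnP exQ) => n /asboolP[g [Ig sg <-]] min_n.
  exists g; split=> // h Ih sh; apply: min_n; apply/asboolP.
  by exists h.
have /choice[nx nxP] : forall s, exists g, (forall x, x \in s -> I x) ->
    [/\ I g, ~ sp s g & forall h, I h -> ~ sp s h -> (size g <= size h)%N].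
  move=> s; have [sI|nsI] := pselect (forall x, x \in s -> I x).
    by have [g gP] := next s sI; exists g.
  by exists 0.
pose G := fix G n := if n is n'.+1 then nx (G n') :: G n' else [::].
have GI n : forall x, x \in G n -> I x.
  elim: n => //= n IHn x; rewrite inE => /predU1P[->|]; last exact: IHn.
  by case: (nxP _ IHn).
pose g n := nx (G n).
have gP n : [/\ I (g n), ~ sp (G n) (g n) &
    forall h, I h -> ~ sp (G n) h -> (size (g n) <= size h)%N] := nxP _ (GI n).
have gG j n : (j < n)%N -> g j \in G n.
  elim: n => // n IHn; rewrite ltnS leq_eqVlt /= inE => /predU1P[->|/IHn->].
    by rewrite eqxx.
  by rewrite orbT.
have Ggen n x : x \in G n -> exists2 j, (j < n)%N & x = g j.
  elim: n => //= n IHn; rewrite inE => /predU1P[->|/IHn[j lt_jn ->]].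
    by exists n.
  by exists j; rewrite // ltnW.
have szg j n : (j <= n)%N -> (size (g j) <= size (g n))%N.
  move=> le_jn; have [_ _ min_j] := gP j; have [In sn _] := gP n.
  apply: min_j => // sjn; apply: sn; apply: (@ideal_gen_min _ _ (sp (G n)) _ _ _ sjn).
    exact: ideal_gen_ideal.
  move=> x /Ggen[l lt_lj ->]; apply: ideal_gen_in.
  exact: gG (leq_trans lt_lj le_jn).
have [m lc_m] := noeR (fun n => lead_coef (g n)).
pose d := (size (g m)).-1.
have szm : size (g m) = d.+1.
  rewrite /d prednK // lt0n size_poly_eq0; apply/negP => /eqP gm0.
  by have [_ + _] := gP m; rewrite gm0; case; apply: sums0.
have [h [sh szh lch]] : exists h,
    [/\ sp (G m) h, (size h <= d.+1)%N & h`_d = lead_coef (g m)].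
  elim: lc_m => [|x [a [y [[j lt_jm ->] ->]]]|x y _ [h1 [s1 sz1 <-]] _ [h2 [s2 sz2 <-]]].
  - by exists 0; split; [exact: sums0 | rewrite size_poly0 | rewrite coef0].
  - have szj := szg j m (ltnW lt_jm); exists (a *: 'X^(size (g m) - size (g j)) * g j).
    split.
    + by case: (ideal_gen_ideal (fun x => x \in G m)) => _ _; apply; apply/ideal_gen_in/gG.
    + rewrite -scalerAl (leq_trans (size_scale_leq _ _)) // -szm.
      have [->|nz_gj] := eqVneq (g j) 0; first by rewrite mulr0 size_poly0.
      by rewrite mulrC size_mulXn // subnK.
    + have nz_gj : g j != 0.
        apply/eqP => gj0; have [_ + _] := gP j; rewrite gj0; case.
        exact: sums0.
      rewrite -scalerAl coefZ coefXnM /d.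
      have szj0 : (0 < size (g j))%N by rewrite size_poly_gt0.
      rewrite ifF; last by apply/negbTE; rewrite -leqNgt -subn1 leq_sub2l.
      by rewrite lead_coefE; congr (_ * _`_ _); lia.
  - exists (h1 + h2); split; first exact: sumsD.
      by rewrite (leq_trans (size_polyD _ _)) // geq_max sz1.
    by rewrite coefD.
have [Im sm min_m] := gP m.
have Ih : I h by apply: ideal_gen_min sh => //; apply: GI.
have := min_m (g m - h); rewrite szm ltnNge => /(_ _ _)/negP[] //.
- exact: idealB.
- move=> s_gmh; apply: sm; rewrite -(subrK h (g m)).
  exact: sumsD.
- apply/leq_sizeP => j; rewrite leq_eqVlt coefB => /predU1P[<-|lt_dj].
    by rewrite lch lead_coefE szm subrr.
  by rewrite !nth_default ?subrr // ?szm // (leq_trans szh).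
Qed.

(** [R] is an iterated polynomial ring over [k]. Relations found in [R] are pushed into [B], so the
    subring generated by [s] needs no ring structure of its own. *)
Lemma noetherian_cover (k : fieldType) (B : comNzRingType) (i : {rmorphism k -> B})
    (s : seq B) : exists (R : comNzRingType) (phi : {rmorphism R -> B}),
  noetherian R /\
  forall y, (exists x, y = phi x) <->
    ring_gen (fun z => (exists c, z = i c) \/ z \in s) y.
Proof.
elim: s => [|b s [R [phi [noeR phiP]]]].
  exists k, i; split=> [|y]; first exact: field_noetherian.
  split=> [iy|]; first by apply: ring_gen_in; left.
  elim=> {y} [y [//|//]|x y _ [c ->] _ [d ->]|x y _ [c ->] _ [d ->]].
    by exists (c + d); rewrite rmorphD.
  by exists (c * d); rewrite rmorphM.
pose psi : {rmorphism {poly R} -> B} := horner_eval b \o map_poly phi.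
have psiE p : psi p = (map_poly phi p).[b] by [].
exists {poly R}, psi; split=> [|y]; first exact: hilbert_basis.
split=> [[p ->]|].
  rewrite psiE horner_coef.
  have g0 : ring_gen (fun z => (exists c, z = i c) \/ z \in b :: s) 0.
    by apply: ring_gen_in; left; exists 0; rewrite rmorph0.
  elim/big_ind: _ => // [x z|j _]; first exact: ring_genD.
  apply: ring_genM.
    rewrite coef_map; have /phiP : exists x, phi p`_j = phi x by exists p`_j.
    apply: ring_gen_sub => z [|s_z]; [by left|right].
    by rewrite inE s_z orbT.
  elim: (j : nat) => [|n IHn].
    by rewrite expr0; apply: ring_gen_in; left; exists 1; rewrite rmorph1.
  rewrite exprS; apply: ring_genM => //.
  by apply: ring_gen_in; right; apply: mem_head.
elim=> {y} [y iy|x y _ [c ->] _ [d ->]|x y _ [c ->] _ [d ->]].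
- have [->|neq_yb] := eqVneq y b; first by exists 'X; rewrite psiE map_polyX hornerX.
  have [|c ->] := (phiP y).2; last by exists c%:P; rewrite psiE map_polyC hornerC.
  by apply: ring_gen_in; case: iy => [|]; [left | rewrite inE (negPf neq_yb); right].
- by exists (c + d); rewrite rmorphD.
- by exists (c * d); rewrite rmorphM.
Qed.

Fixpoint ideal_pow (R : pzRingType) (I : R -> Prop) (s : nat) : R -> Prop :=
  if s is s'.+1
  then sums (fun y => exists u f, [/\ I u, ideal_pow I s' f & y = u * f])
  else fun=> True.
Arguments ideal_pow : simpl never.

Section IdealPower.
Variables (R : comPzRingType) (I : R -> Prop).
Hypothesis idI : is_ideal I.
Local Notation "'I^ s" := (ideal_pow I s) (at level 8, s at level 2).

Lemma ideal_pow_ideal s : is_ideal ('I^s).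
Proof.
elim: s => [|s [IH0 IHD IHM]]; first by split.
split=> [|x y|a x]; [exact: sums0 | exact: sumsD |].
elim=> [|{}x [u [f [Iu If ->]]]|{}x y _ IHx _ IHy]; first by rewrite mulr0; apply: sums0.
  by rewrite mulrCA; apply: sums_in; exists u, (a * f); split=> //; apply: IHM.
by rewrite mulrDr; apply: sumsD.
Qed.

Lemma ideal_pow0 s : 'I^s 0. Proof. by case: (ideal_pow_ideal s). Qed.
Lemma ideal_powD s x y : 'I^s x -> 'I^s y -> 'I^s (x + y).
Proof. by case: (ideal_pow_ideal s) => _ + _; apply. Qed.
Lemma ideal_powMr s a x : 'I^s x -> 'I^s (a * x).
Proof. by case: (ideal_pow_ideal s) => _ _; apply. Qed.
Lemma ideal_powMl s a x : 'I^s x -> 'I^s (x * a).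
Proof. by rewrite mulrC; apply: ideal_powMr. Qed.
Lemma ideal_powB s x y : 'I^s x -> 'I^s y -> 'I^s (x - y).
Proof. exact: idealB (ideal_pow_ideal s). Qed.
Lemma ideal_powN s x : 'I^s x -> 'I^s (- x).
Proof. by rewrite -sub0r; apply/ideal_powB/ideal_pow0. Qed.

Lemma ideal_pow1 x : 'I^1 x <-> I x.
Proof.
case: idI => I0 ID IM; split=> [|Ix]; last first.
  by apply: sums_in; exists x, 1; rewrite mulr1.
elim=> [//|{}x [u [f [Iu _ ->]]]|{}x y _ Ix _ Iy]; last exact: ID.
by rewrite mulrC; apply: IM.
Qed.

Lemma ideal_powS s u f : I u -> 'I^s f -> 'I^s.+1 (u * f).
Proof. by move=> Iu If; apply: sums_in; exists u, f. Qed.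

Lemma ideal_pow_mul s t x y : 'I^s x -> 'I^t y -> 'I^(s + t) (x * y).
Proof.
elim: s x => [|s IHs] x; first by move=> _; apply: ideal_powMr.
move=> Isx Ity; elim: Isx => [|{}x [u [f [Iu If ->]]]|{}x z _ IHx _ IHz].
- by rewrite mul0r; apply: ideal_pow0.
- by rewrite -mulrA addSn; apply: ideal_powS => //; apply: IHs.
- by rewrite mulrDl; apply: ideal_powD.
Qed.

Lemma ideal_pow_le s t x : (s <= t)%N -> 'I^t x -> 'I^s x.
Proof.
move=> /subnK <-; elim: (t - s)%N x => // d IHd x.
rewrite addSn; elim=> [|{}x [u [f [Iu If ->]]]|{}x z _ IHx _ IHz].
- exact: ideal_pow0.
- by apply: ideal_powMr; apply: IHd.
- exact: ideal_powD.
Qed.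

End IdealPower.

(* The sequence [f 'X^s] in the Rees ring [A[mX]], which is Noetherian: a
   relation of degree [s] gives [f = f * u] with [u] in [m]. *)
Lemma krull_intersection (k : fieldType) (A : idomainType) (i : {rmorphism k -> A})
    (s : seq A) (ev : {rmorphism A -> k}) (f : A) :
  (forall a, ring_gen (fun z => (exists c, z = i c) \/ z \in s) a) ->
  (forall c, ev (i c) = c) ->
  (forall n, ideal_pow (fun a => ev a = 0) n f) -> f = 0.
Proof.
move=> gen_s evi fI; pose m a := ev a = 0.
have idm : is_ideal m := kernel_ideal ev.
pose i' : {rmorphism k -> {poly A}} := polyC \o i.
pose t := map polyC s ++ map (fun x => (x - i (ev x)) *: 'X) s.
have [R [phi [noeR phiP]]] := noetherian_cover i' t.
pose im y := exists x, y = phi x.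
have imD x y : im x -> im y -> im (x + y).
  by move=> [u ->] [v ->]; exists (u + v); rewrite rmorphD.
have imM x y : im x -> im y -> im (x * y).
  by move=> [u ->] [v ->]; exists (u * v); rewrite rmorphM.
have im0 : im 0 by exists 0; rewrite rmorph0.
have im_i c : im (i c)%:P by apply/phiP/ring_gen_in; left; exists c.
have imC a : im a%:P.
  elim: (gen_s a) => {a} [a [[c ->]|s_a]|x y _ Gx _ Gy|x y _ Gx _ Gy].
  - exact: im_i.
  - by apply/phiP/ring_gen_in; right; rewrite mem_cat map_f.
  - by rewrite rmorphD; apply: imD.
  - by rewrite rmorphM; apply: imM.
have imX a : im ((a - i (ev a)) *: 'X).
  elim: (gen_s a) => {a} [a [[c ->]|s_a]|x y _ Gx _ Gy|x y _ Gx _ Gy].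
  - by rewrite evi subrr scale0r.
  - apply/phiP/ring_gen_in; right; rewrite mem_cat; apply/orP; right.
    by apply/mapP; exists a.
  - by rewrite !rmorphD opprD addrACA scalerDl; apply: imD.
  - have -> : (x * y - i (ev (x * y))) *: 'X
        = x%:P * ((y - i (ev y)) *: 'X) + (i (ev y))%:P * ((x - i (ev x)) *: 'X).
      by rewrite !mul_polyC !scalerA -scalerDl !rmorphM; congr (_ *: _); ring.
    by apply: imD; apply: imM.
have im_pow n g : ideal_pow m n g -> im (g *: 'X^n).
  elim: n g => [|n IHn] g; first by rewrite expr0 alg_polyC.
  elim=> [|{}g [u [h [mu mh ->]]]|{}g h _ IHg _ IHh].
  - by rewrite scale0r.
  - have -> : (u * h) *: 'X^(n.+1) = (u *: 'X) * (h *: 'X^n).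
      by rewrite -scalerAl -scalerAr scalerA exprS.
    apply: imM; last exact: IHn.
    by have := imX u; rewrite mu rmorph0 subr0.
  - by rewrite scalerDl; apply: imD.
(* Conversely, the image of [phi] lies in the Rees ring. *)
have coef_im r j : ideal_pow m j (phi r)`_j.
  have /phiP : exists x, phi r = phi x by exists r.
  move=> gr; elim: gr j => {r} [y [[c ->]|t_y]|x y _ Gx _ Gy|x y _ Gx _ Gy] j.
  - rewrite coefC; case: eqP => [->|_] //; exact: ideal_pow0.
  - move: t_y; rewrite mem_cat => /orP[] /mapP[z _ ->].
      rewrite coefC; case: eqP => [->|_] //; exact: ideal_pow0.
    rewrite coefZ coefX; case: eqP => [->|_]; last by rewrite mulr0; apply: ideal_pow0.
    by rewrite mulr1; apply/ideal_pow1 => //; rewrite /m rmorphB evi subrr.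
  - by rewrite coefD; apply: ideal_powD.
  - rewrite coefM; elim/big_ind: _ => [|a b|l _]; [exact: ideal_pow0|exact: ideal_powD|].
    have := ideal_pow_mul (Gx l) (Gy (j - l)%N).
    by rewrite subnKC // -ltnS.
have /choice[a aE] n : exists x, f *: 'X^n = phi x by apply: im_pow.
have [n an] := noeR a.
(* Compare coefficients of degree [n] in the relation for [a n]: the term in [a j] contributes [f]
   times a coefficient of positive degree [n - j], which lies in [m]. *)
have [u mu fu] : exists2 u, m u & (phi (a n))`_n = u * f.
  elim: an => [|x [b [y [[j lt_jn ->] ->]]]|x y _ [u mu ux] _ [v mv vy]].
  - by exists 0; rewrite ?rmorph0 ?coef0 ?mul0r //; case: idm.
  - rewrite rmorphM -aE -scalerAr coefZ coefMXn ltnNge (ltnW lt_jn) /= mulrC.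
    exists (phi b)`_(n - j) => //; apply/ideal_pow1 => //.
    by apply: ideal_pow_le (coef_im _ _); rewrite ?subn_gt0.
  - exists (u + v); first by case: idm => _ + _; apply.
    by rewrite rmorphD coefD ux vy mulrDl.
move: fu; rewrite -aE coefZ coefXn eqxx mulr1 -{1}[f]mul1r => /eqP.
rewrite -subr_eq0 -mulrBl mulf_eq0 => /orP[/eqP|/eqP //].
move/(congr1 ev); rewrite rmorphB mu rmorph1 rmorph0 subr0 => /eqP.
by rewrite oner_eq0.
Qed.

(** * Derivations and the filtration by m^s Der(A) *)

Lemma matrices_dependent (k : fieldType) (r N : nat) (w : 'I_N -> 'M[k]_r) :
  (r * r < N)%N ->
  exists c : 'I_N -> k, (exists i, c i != 0) /\ \sum_i c i *: w i = 0.
Proof.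
move=> lt_rN; pose W := \matrix_(i < N) mxvec (w i).
have : kermx W != 0.
  rewrite -mxrank_eq0 mxrank_ker -lt0n subn_gt0.
  by rewrite (leq_ltn_trans (rank_leq_col _)).
case/rowV0Pn => c /sub_kermxP cW0 nz_c.
exists (c 0); split; first by have /rV0Pn := nz_c.
apply: (can_inj mxvecK); rewrite linear_sum linear0 -[RHS]cW0 mulmx_sum_row.
by apply: eq_bigr => i _; rewrite linearZ rowK.
Qed.

Section DerivationTheory.
Variables (k : fieldType) (A : comAlgType k).
Implicit Types (X Y Z eta mu : Der A) (f g h : A).

(* The value in [A] rather than in the left module [A^o]; locked, because the
   rules below would otherwise also match the unfolding of [dval (a *: eta)]. *)
Definition dval eta f : A := locked (der_fun eta) f.

Lemma dvalK eta f : dval eta f = eta f. Proof. by rewrite /dval -lock. Qed.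

Lemma der_ext eta mu : dval eta =1 dval mu -> eta = mu.
Proof. by move=> eq_em; apply/val_inj/funext => f; have := eq_em f; rewrite !dvalK. Qed.

Lemma dvalM eta f g : dval eta (f * g) = dval eta f * g + f * dval eta g.
Proof. by rewrite !dvalK; case: (derP eta) => _; apply. Qed.
Lemma dval_lin eta c f g : dval eta (c *: f + g) = c *: dval eta f + dval eta g.
Proof. by rewrite !dvalK; case: (derP eta) => + _; apply. Qed.
Lemma dvalDr eta f g : dval eta (f + g) = dval eta f + dval eta g.
Proof. by have := dval_lin eta 1 f g; rewrite !scale1r. Qed.
Lemma dval0r eta : dval eta 0 = 0.
Proof. by apply: (addrI (dval eta 0)); rewrite -dvalDr !addr0. Qed.
Lemma dvalZr eta c f : dval eta (c *: f) = c *: dval eta f.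
Proof. by rewrite -[c *: f]addr0 dval_lin dval0r addr0. Qed.
Lemma dvalNr eta f : dval eta (- f) = - dval eta f.
Proof. by rewrite -scaleN1r dvalZr scaleN1r. Qed.
Lemma dvalBr eta f g : dval eta (f - g) = dval eta f - dval eta g.
Proof. by rewrite dvalDr dvalNr. Qed.
Lemma dval1 eta : dval eta 1 = 0.
Proof.
by apply: (addrI (dval eta 1)); rewrite addr0 -{3}[1]mul1r dvalM mul1r mulr1.
Qed.
Lemma dvalC eta c : dval eta c%:A = 0.
Proof. by rewrite dvalZr dval1 scaler0. Qed.
Lemma dval_sumr eta (I : finType) (F : I -> A) :
  dval eta (\sum_i F i) = \sum_i dval eta (F i).
Proof. exact: (big_morph (dval eta) (dvalDr eta) (dval0r eta)). Qed.

Lemma dval0l f : dval 0 f = 0. Proof. by rewrite !dvalK. Qed.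
Lemma dvalDl X Y f : dval (X + Y) f = dval X f + dval Y f. Proof. by rewrite !dvalK. Qed.
Lemma dvalNl X f : dval (- X) f = - dval X f. Proof. by rewrite !dvalK. Qed.
Lemma dvalZl a X f : dval (a *: X) f = a * dval X f. Proof. by rewrite !dvalK. Qed.
Lemma dval_suml (I : finType) (F : I -> Der A) f :
  dval (\sum_i F i) f = \sum_i dval (F i) f.
Proof. exact: (big_morph (dval^~ f) (fun X Y => dvalDl X Y f) (dval0l f)). Qed.
Lemma dval_bracket X Y f :
  dval (der_bracket X Y) f = dval X (dval Y f) - dval Y (dval X f).
Proof. by rewrite !dvalK. Qed.

Definition dvalE := (dval0l, dval0r, dvalDl, dvalNl, dvalZl, dval_bracket,
  dvalDr, dvalNr, dvalM).

Lemma bracketDl X Y Z : der_bracket (X + Y) Z = der_bracket X Z + der_bracket Y Z.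
Proof. by apply: der_ext => f; rewrite !dvalE; ring. Qed.
Lemma bracketDr X Y Z : der_bracket X (Y + Z) = der_bracket X Y + der_bracket X Z.
Proof. by apply: der_ext => f; rewrite !dvalE; ring. Qed.
Lemma bracket0l X : der_bracket 0 X = 0.
Proof. by apply: der_ext => f; rewrite !dvalE; ring. Qed.
Lemma bracket0r X : der_bracket X 0 = 0.
Proof. by apply: der_ext => f; rewrite !dvalE; ring. Qed.
Lemma bracketZ f g X Y : der_bracket (f *: X) (g *: Y) =
  (f * dval X g) *: Y - (g * dval Y f) *: X + (f * g) *: der_bracket X Y.
Proof. by apply: der_ext => h; rewrite !dvalE; ring. Qed.

End DerivationTheory.

Section PowersTimesDerivations.
Variables (k : fieldType) (A : comAlgType k) (m : A -> Prop).
Implicit Types (X Y Z eta mu : Der A) (f g h : A).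
Local Notation "'m^ s" := (ideal_pow m s) (at level 8, s at level 2).

Definition pow_der (s : nat) : Der A -> Prop :=
  sums (fun X => exists f eta, 'm^s f /\ X = f *: eta).

Lemma pow_der_in s f eta : 'm^s f -> pow_der s (f *: eta).
Proof. by move=> mf; apply: sums_in; exists f, eta. Qed.

Lemma pow_derZ s t g X : 'm^t g -> pow_der s X -> pow_der (t + s) (g *: X).
Proof.
move=> mg; elim=> [|{}X [f [eta [mf ->]]]|{}X Y _ IHX _ IHY].
- by rewrite scaler0; apply: sums0.
- by rewrite scalerA; apply/pow_der_in/ideal_pow_mul.
- by rewrite scalerDr; apply: sumsD.
Qed.

Lemma pow_derA s a X : pow_der s X -> pow_der s (a *: X).
Proof. by move=> mX; apply: (@pow_derZ s 0). Qed.

Lemma pow_derN s X : pow_der s X -> pow_der s (- X).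
Proof. by move=> mX; rewrite -scaleN1r; apply: pow_derA. Qed.

Lemma pow_derB s X Y : pow_der s X -> pow_der s Y -> pow_der s (X - Y).
Proof. by move=> mX mY; apply/sumsD/pow_derN. Qed.

Lemma pow_der_le s t X : (s <= t)%N -> pow_der t X -> pow_der s X.
Proof.
move=> le_st; apply: sums_sub => {}X [f [eta [mf ->]]].
by exists f, eta; split=> //; apply: ideal_pow_le mf.
Qed.

Lemma dval_ideal_pow s eta f : 'm^s.+1 f -> 'm^s (dval eta f).
Proof.
elim: s f => [//|s IHs] f; elim=> [|{}f [u [g [mu mg ->]]]|{}f g _ IHf _ IHg].
- by rewrite dval0r; apply: ideal_pow0.
- rewrite dvalM; apply: ideal_powD; first exact: ideal_powMr.
  by apply: ideal_powS => //; apply: IHs.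
- by rewrite dvalDr; apply: ideal_powD.
Qed.

Lemma pow_der_dval s X f : pow_der s X -> 'm^s (dval X f).
Proof.
elim=> [|{}X [g [eta [mg ->]]]|{}X Y _ IHX _ IHY].
- by rewrite dval0l; apply: ideal_pow0.
- by rewrite dvalZl; apply: ideal_powMl.
- by rewrite dvalDl; apply: ideal_powD.
Qed.

Lemma pow_der_dval_pow s t X f : pow_der s X -> 'm^t.+1 f -> 'm^(s + t) (dval X f).
Proof.
move=> + mf; elim=> [|{}X [g [eta [mg ->]]]|{}X Y _ IHX _ IHY].
- by rewrite dval0l; apply: ideal_pow0.
- by rewrite dvalZl; apply/ideal_pow_mul/dval_ideal_pow.
- by rewrite dvalDl; apply: ideal_powD.
Qed.

Lemma pow_der1_dval_pow t X f : pow_der 1 X -> 'm^t f -> 'm^t (dval X f).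
Proof. by case: t => // t mX mf; rewrite -[t.+1]add1n; apply: pow_der_dval_pow. Qed.

(** Each term of the bracket differentiates at most one of the two coefficients, which costs at most
    one order of vanishing. *)
Lemma pow_der_bracket s t X Y : pow_der s.+1 X -> pow_der t.+1 Y ->
  pow_der (s + t).+1 (der_bracket X Y).
Proof.
move=> mX mY; elim: mX => [|{}X [f [eta [mf ->]]]|X1 X2 _ IH1 _ IH2]; last first.
- by rewrite bracketDl; apply: sumsD.
- elim: mY => [|{}Y [g [mu [mg ->]]]|Y1 Y2 _ IH1 _ IH2]; last first.
  + by rewrite bracketDr; apply: sumsD.
  + rewrite bracketZ; apply: sumsD.
      apply: pow_derB; apply: pow_der_in.
        rewrite -addSn; apply: ideal_pow_mul => //; exact: dval_ideal_pow.
      rewrite addnC -addSn; apply: ideal_pow_mul => //; exact: dval_ideal_pow.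
    apply: pow_der_in; apply: ideal_pow_le (ideal_pow_mul mf mg).
    by rewrite addSn addnS.
  + by rewrite bracket0r; apply: sums0.
- by rewrite bracket0l; apply: sums0.
Qed.

End PowersTimesDerivations.

(** * Euler fields *)

Definition der_simple (k : fieldType) (A : comAlgType k) :=
  forall J : A -> Prop, is_ideal J ->
    (forall eta f, J f -> J (dval eta f)) -> (exists2 f, J f & f != 0) -> J 1.

(** The coordinate-free traces of [sum_i t_i d/dt_i]: it vanishes at the point, is the identity on
    [m / m^2], and its adjoint action on [Der(A) / m Der(A)] is [- 1]. *)
Definition euler_field (k : fieldType) (A : comAlgType k) (m : A -> Prop)
    (E : Der A) :=
  [/\ pow_der m 1 E,
      forall f, m f -> ideal_pow m 2 (dval E f - f) &
      forall eta, pow_der m 1 (eta + der_bracket E eta)].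

Section Euler.
Variables (k : fieldType) (A : comAlgType k) (m : A -> Prop) (E : Der A).
Hypotheses (idm : is_ideal m) (eulE : euler_field m E).
Local Notation "'m^ s" := (ideal_pow m s) (at level 8, s at level 2).

Let mE : pow_der m 1 E. Proof. by case: eulE. Qed.

(** By the Leibniz rule the weights of the factors of a product add up. *)
Lemma euler_pow s f : 'm^s f -> 'm^s.+1 (dval E f - s%:R * f).
Proof.
elim: s f => [|s IHs] f.
  by move=> _; rewrite mul0r subr0; apply: pow_der_dval.
elim=> [|{}f [u [g [mu mg ->]]]|{}f g _ IHf _ IHg].
- by rewrite dval0r mulr0 subrr; apply: ideal_pow0.
- have -> : dval E (u * g) - s.+1%:R * (u * g)
      = u * (dval E g - s%:R * g) + (dval E u - u) * g.
    by rewrite dvalM -natr1; ring.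
  apply: ideal_powD; first by apply: ideal_powS => //; apply: IHs.
  by apply: (@ideal_pow_mul _ _ 2) => //; case: eulE => _ + _; apply.
- have -> : dval E (f + g) - s.+1%:R * (f + g)
    = dval E f - s.+1%:R * f + (dval E g - s.+1%:R * g) by rewrite dvalDr; ring.
  exact: ideal_powD.
Qed.

(** The coefficient contributes the weight [s + 1], the derivation the weight [- 1]. *)
Lemma euler_bracket s X : pow_der m s.+1 X ->
  pow_der m s.+2 (der_bracket E X - (s%:R : A) *: X).
Proof.
elim=> [|{}X [f [eta [mf ->]]]|{}X Y _ IHX _ IHY].
- by rewrite bracket0r scaler0 subrr; apply: sums0.
- have -> : der_bracket E (f *: eta) - (s%:R : A) *: (f *: eta)
      = (dval E f - s.+1%:R * f) *: eta + f *: (eta + der_bracket E eta).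
    by apply: der_ext => h; rewrite !dvalE -natr1; ring.
  apply: sumsD; first by apply/pow_der_in/euler_pow.
  rewrite -[s.+2]addn1; apply: pow_derZ mf _.
  by case: eulE => _ _; apply.
- have -> : der_bracket E (X + Y) - (s%:R : A) *: (X + Y)
    = der_bracket E X - (s%:R : A) *: X + (der_bracket E Y - (s%:R : A) *: Y).
    by rewrite bracketDr scalerDr opprD addrACA.
  exact: sumsD.
Qed.

Definition bracket_span s t : Der A -> Prop :=
  sums (fun X => exists Y Z, [/\ pow_der m s Y, pow_der m t Z & X = der_bracket Y Z]).

Lemma bracket_spanZ s t X (c : k) : bracket_span s t X -> bracket_span s t (c%:A *: X).
Proof.
elim=> [|{}X [Y [Z [mY mZ ->]]]|{}X Y _ IHX _ IHY].
- by rewrite scaler0; apply: sums0.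
- apply: sums_in; exists (c%:A *: Y), Z; split=> //; first exact: pow_derA.
  by apply: der_ext => f; rewrite !dvalE dvalC; ring.
- by rewrite scalerDr; apply: sumsD.
Qed.

(** Membership in [[m^2 Der, m^s Der] + m^(s+2) Der]. For [s > 0] these brackets lie in
    [m^(s+1) Der]; the aim is that they fill it modulo the next step. *)
Definition bracket_mod s X := exists2 B, bracket_span 2 s B & pow_der m s.+2 (X - B).

Lemma bracket_modD s X Y : bracket_mod s X -> bracket_mod s Y -> bracket_mod s (X + Y).
Proof.
move=> [B sB mB] [C sC mC]; exists (B + C); first exact: sumsD.
by rewrite opprD addrACA; apply: sumsD.
Qed.

Lemma bracket_modZ s X (c : k) : bracket_mod s X -> bracket_mod s (c%:A *: X).
Proof.
move=> [B sB mB]; exists (c%:A *: B); first exact: bracket_spanZ.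
by rewrite -scalerBr; apply: pow_derA.
Qed.

Lemma bracket_mod0 s : bracket_mod s 0.
Proof. by exists 0; rewrite ?subr0; apply: sums0. Qed.

Lemma bracket_mod_in s Y Z R : pow_der m 2 Y -> pow_der m s Z ->
  pow_der m s.+2 R -> bracket_mod s (der_bracket Y Z + R).
Proof.
move=> mY mZ mR; exists (der_bracket Y Z).
  by apply: sums_in; exists Y, Z.
by rewrite addrAC subrr add0r.
Qed.

Hypothesis char0 : [pchar k] =i pred0.

Lemma natrA_scale s : (s%:R : A) = (s%:R : k)%:A.
Proof. by rewrite scaler_nat. Qed.

Lemma bracket_mod_nat s n X : bracket_mod s ((n.+1%:R : A) *: X) -> bracket_mod s X.
Proof.
move/(bracket_modZ (n.+1%:R : k)^-1); rewrite natrA_scale !scalerA.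
rewrite -scalerAl mul1r scalerA mulVf ?scale1r //.
by rewrite ?scale1r; have /pcharf0P -> := char0.
Qed.

Lemma pow2_scaleE u : m u -> pow_der m 2 (u *: E).
Proof.
by move=> mu; apply: (@pow_derZ _ _ _ 1 1) => //; apply/ideal_pow1.
Qed.

(** For [u] in [m] and [g] in [m^(s-1)], the bracket [[u E, g E] = (u E(g) - g E(u)) E] is
    [(s - 2) u g E] modulo [m^(s+2) Der]. The bound on [s] makes [s - 2] invertible. *)
Lemma euler_bracket_mod s f : (2 < s)%N -> 'm^s f -> bracket_mod s (f *: E).
Proof.
case: s => [|[|[|s]]] // _; elim=> [|{}f [u [g [mu mg ->]]]|{}f g _ IHf _ IHg].
- by rewrite scale0r; apply: bracket_mod0.
- have {}mg : 'm^s.+2 g := mg; apply: (@bracket_mod_nat _ s).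
  have -> : (s.+1%:R : A) *: ((u * g) *: E) = der_bracket (u *: E) (g *: E) +
      (- (u * (dval E g - s.+2%:R * g)) + (g * (dval E u - u))) *: E.
    by apply: der_ext => h; rewrite !dvalE -[s.+2%:R]natr1; ring.
  apply: bracket_mod_in; first exact: pow2_scaleE.
    by rewrite -[s.+3]addn1; apply: pow_derZ mg mE.
  rewrite -[s.+1.+4]addn1; apply: pow_derZ mE.
  apply: ideal_powD.
    apply: ideal_powN; apply: ideal_powS => //; exact: euler_pow.
  rewrite -addn2; apply: ideal_pow_mul => //.
  by case: eulE => _ + _; apply.
- by rewrite scalerDl; apply: bracket_modD.
Qed.

(** For [u] in [m] and [g] in [m^s], the bracket [[u E, g eta]] is [(s - 1) u g eta - eta(u) g E]
    modulo [m^(s+2) Der], and the last term is handled by [euler_bracket_mod]. *)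
Lemma pow_der_bracket_mod s X : (2 < s)%N -> pow_der m s.+1 X -> bracket_mod s X.
Proof.
case: s => [|s] // lt2s.
elim=> [|{}X [f [eta [mf ->]]]|{}X Y _ IHX _ IHY]; last exact: bracket_modD.
  exact: bracket_mod0.
elim: mf => [|{}f [u [g [mu mg ->]]]|{}f g _ IHf _ IHg].
- by rewrite scale0r; apply: bracket_mod0.
- case: s => [|s] // in lt2s mg *.
  have {}mg : 'm^s.+2 g := mg; apply: (@bracket_mod_nat _ s).
  have -> : (s.+1%:R : A) *: ((u * g) *: eta) =
      (der_bracket (u *: E) (g *: eta) +
       ((- (u * (dval E g - s.+2%:R * g))) *: eta
        - (u * g) *: (eta + der_bracket E eta))) + (dval eta u * g) *: E.
    by apply: der_ext => h; rewrite !dvalE -[s.+2%:R]natr1; ring.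
  apply: bracket_modD; last by apply: euler_bracket_mod => //; apply: ideal_powMr.
  apply: bracket_mod_in; [exact: pow2_scaleE | exact: pow_der_in |].
  apply: pow_derB.
    apply/pow_der_in/ideal_powN/ideal_powS => //; exact: euler_pow.
  rewrite -[s.+4]addn1; apply: pow_derZ; last by case: eulE => _ _; apply.
  exact: ideal_powS.
- by rewrite scalerDl; apply: bracket_modD.
Qed.

End Euler.

(** * Finite-dimensional representations of m Der(A) *)

Section LocalRepresentation.
Variables (k : closedFieldType) (A : idomainAlgType k) (ev : {rmorphism A -> k}).
Variables (E : Der A) (r : nat) (sigma : Der A -> 'M[k]_r).
Hypothesis char0 : [pchar k] =i pred0.
Hypothesis evC : forall c, ev c%:A = c.
Let m (f : A) := ev f = 0.
Hypothesis eulE : euler_field m E.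
Hypothesis simA : der_simple A.
Hypothesis sigma_lin : forall c X Y, sigma (c%:A *: X + Y) = c *: sigma X + sigma Y.
(** The order of the products is reversed because the matrices will act on row vectors. *)
Hypothesis sigma_bracket : forall X Y, pow_der m 1 X -> pow_der m 1 Y ->
  sigma (der_bracket X Y) = sigma Y *m sigma X - sigma X *m sigma Y.
Local Notation "'m^ s" := (ideal_pow m s) (at level 8, s at level 2).

Let idm : is_ideal m := kernel_ideal ev.

Let sigmaD X Y : sigma (X + Y) = sigma X + sigma Y.
Proof. by have := sigma_lin 1 X Y; rewrite !scale1r. Qed.
Let sigma0 : sigma 0 = 0.
Proof. by apply: (addrI (sigma 0)); rewrite -sigmaD !addr0. Qed.
Let sigmaZ c X : sigma (c%:A *: X) = c *: sigma X.
Proof. by rewrite -[c%:A *: X]addr0 sigma_lin sigma0 addr0. Qed.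
Let sigmaN X : sigma (- X) = - sigma X.
Proof.
have -> : - X = (- 1 : k)%:A *: X by rewrite !scaleN1r.
by rewrite sigmaZ scaleN1r.
Qed.
Let sigmaB X Y : sigma (X - Y) = sigma X - sigma Y.
Proof. by rewrite sigmaD sigmaN. Qed.

Let mderD X Y : pow_der m 1 X -> pow_der m 1 Y -> pow_der m 1 (X + Y).
Proof. exact: sumsD. Qed.
Let mderB X Y : pow_der m 1 X -> pow_der m 1 Y -> pow_der m 1 (der_bracket X Y).
Proof. exact: (@pow_der_bracket _ _ _ 0 0). Qed.

Let ker X := pow_der m 1 X /\ sigma X = 0.

Let kerD X Y : ker X -> ker Y -> ker (X + Y).
Proof.
by move=> [mX sX] [mY sY]; split; [exact: mderD | rewrite sigmaD sX sY addr0].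
Qed.
Let kerZ c X : ker X -> ker (c%:A *: X).
Proof.
by move=> [mX sX]; split; [exact: pow_derA | rewrite sigmaZ sX scaler0].
Qed.
Let kerN X : ker X -> ker (- X).
Proof. by move=> [mX sX]; split; [exact: pow_derN | rewrite sigmaN sX oppr0]. Qed.
Let ker_bracket X Y : ker X -> pow_der m 1 Y -> ker (der_bracket X Y).
Proof.
move=> [mX sX] mY; split; first exact: mderB.
by rewrite sigma_bracket // sX mulmx0 mul0mx subrr.
Qed.
Let ker_half X : ker ((2%:R : A) *: X) -> ker X.
Proof.
move/(kerZ (2%:R : k)^-1); rewrite (natrA_scale A) scalerA -scalerAl mul1r.
by rewrite scalerA mulVf ?scale1r //; have /pcharf0P -> := char0.
Qed.

(* Grabowski's trick for ideals of finite codimension in Lie algebras of vector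
   fields: from [g D] in the kernel, brackets put [g^3 D(h)^2 A D] in the
   kernel, and then a whole module [f Der(A)]. *)
Let ker_mul2 D g g' f : pow_der m 1 D -> ker (g *: D) -> ker (g' *: D) ->
  ker ((g * g' * dval D f) *: D).
Proof.
move=> mD kg kg'; apply: ker_half.
have -> : (2%:R : A) *: ((g * g' * dval D f) *: D) =
   der_bracket (g *: D) ((f * g') *: D) + der_bracket (g' *: D) ((f * g) *: D).
  by apply: der_ext => h; rewrite !dvalE; ring.
by apply: kerD; apply: ker_bracket => //; apply: pow_derA.
Qed.

(** Two uses of [ker_mul2] reach the coefficients [g^3 D(b) D(c)]. The identity
    [2 a D(h)^2 = 2 D(h) D(h a) - D(a) D(h^2)] then frees [a] from the derivative. *)
Let ker_module D g h a : pow_der m 1 D -> ker (g *: D) ->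
  ker ((g ^+ 3 * dval D h ^+ 2 * a) *: D).
Proof.
move=> mD kg.
have kk b c : ker ((g ^+ 3 * dval D b * dval D c) *: D).
  have -> : g ^+ 3 * dval D b * dval D c = g * (g * g * dval D b) * dval D c by ring.
  by apply: ker_mul2 => //; apply: ker_mul2.
apply: ker_half; have -> : (2%:R : A) *: ((g ^+ 3 * dval D h ^+ 2 * a) *: D) =
    (g ^+ 3 * dval D h * dval D (h * a)) *: D +
    (g ^+ 3 * dval D h * dval D (h * a)) *: D -
    (g ^+ 3 * dval D a * dval D (h * h)) *: D.
  by apply: der_ext => f; rewrite !dvalE; ring.
by apply: kerD; [apply: kerD | apply: kerN].
Qed.

(** The brackets [[q a D, b Y]] and [[q a b D, Y]] differ by [q a D(b) Y] plus a multiple of [q D].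
    This leads from the single field [D] to an arbitrary [Y]. *)
Let ker_spread D q b a Y : (forall c, ker ((q * c) *: D)) -> pow_der m 1 Y ->
  ker ((q * dval D b * a) *: Y).
Proof.
move=> kq mY.
have -> : (q * dval D b * a) *: Y = der_bracket ((q * a) *: D) (b *: Y)
    - der_bracket ((q * (a * b)) *: D) Y - (q * (a * dval Y b)) *: D.
  by apply: der_ext => f; rewrite !dvalE; ring.
apply: kerD; last by apply: kerN.
apply: kerD; last by apply/kerN/ker_bracket.
by apply: ker_bracket => //; apply: pow_derA.
Qed.

Let ker_ideal f := m f /\ forall eta, sigma (f *: eta) = 0.

(** The [r^2 + 1] matrices [sigma (h^i D)] are dependent, so [g D] is in the kernel for some
    polynomial [g] in [h]. It is nonzero: in a domain over the algebraically closed [k], a root of a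
    nonzero polynomial is a constant, while [eta(h) != 0]. *)
Let ker_ideal_exists : (exists eta : Der A, eta <> 0) ->
  exists2 f, ker_ideal f & f != 0.
Proof.
case=> eta nz_eta.
have [h etah] : exists h, dval eta h != 0.
  apply: contrapT => noh; apply/nz_eta/der_ext => h; rewrite dval0l.
  by apply/eqP/negP => /negP etah; apply: noh; exists h.
pose u := h - (ev h)%:A.
have mu : m u by rewrite /m rmorphB evC subrr.
have etau : dval eta u = dval eta h by rewrite dvalBr dvalC subr0.
have nz_u : u != 0 by apply: contraNneq etah => u0; rewrite -etau u0 dval0r.
pose D := u *: eta.
have mD : pow_der m 1 D by apply: pow_der_in; apply/ideal_pow1.
have nz_Du : dval D u != 0 by rewrite dvalZl etau mulf_neq0.
have [c [[i0 nz_ci0] c0]] := @matrices_dependent k r (r * r).+1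
  (fun i => sigma ((h ^+ i) *: D)) (ltnSn _).
pose p := \poly_(i < (r * r).+1) c (inord i).
have nz_p : p != 0.
  apply: contraNneq nz_ci0 => /(congr1 (fun q : {poly k} => q`_i0)).
  by rewrite coef0 coef_poly ltn_ord inord_val => ->.
pose j : {rmorphism k -> A} := in_alg A.
pose g := \sum_(i < (r * r).+1) (c i)%:A * h ^+ i.
have gE : g = (map_poly j p).[h].
  rewrite (@horner_coef_wide _ (r * r).+1); last first.
    by rewrite (leq_trans (size_poly _ _)) // size_poly.
  by apply: eq_bigr => i _; rewrite coef_map coef_poly ltn_ord inord_val.
have nz_g : g != 0.
  apply: contra_neqN etah => /eqP; rewrite gE => /eqP ph0.
  have [|c' ->] := @closed_field_root k A j h p _ nz_p ph0.
    by move=> x y /eqP; rewrite mulf_eq0 => /orP[] /eqP; [left | right].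
  exact: dvalC.
have kg : ker (g *: D).
  split; first exact: pow_derA.
  rewrite -[RHS]c0 scaler_suml (big_morph sigma sigmaD sigma0).
  by apply: eq_bigr => i _; rewrite -scalerA sigmaZ.
(* The first two factors come from [ker_module], the third from [ker_spread]; the last one moves any
   derivation into [m Der(A)]. *)
exists (g ^+ 3 * dval D u ^+ 2 * dval D u * u); last first.
  by rewrite !mulf_neq0 // expf_neq0.
split; first by rewrite /m rmorphM mu mulr0.
move=> mu'; rewrite -scalerA -[g ^+ 3 * _ * _]mulr1.
suff [_ ->] : ker ((g ^+ 3 * dval D u ^+ 2 * dval D u * 1) *: (u *: mu')) by [].
apply: ker_spread => [b|]; first exact: ker_module.
by apply: pow_der_in; apply/ideal_pow1.
Qed.

Let ker_ideal_stable f X : ker_ideal f -> pow_der m 1 X -> ker_ideal (dval X f).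
Proof.
move=> [mf sf] mX; split.
  by apply/ideal_pow1 => //; apply: pow_der_dval.
move=> eta; have : sigma (der_bracket X (f *: eta)) = 0.
  rewrite sigma_bracket // ?sf ?mul0mx ?mulmx0 ?subrr //.
  by apply: pow_der_in; apply/ideal_pow1.
have -> : der_bracket X (f *: eta) = dval X f *: eta + f *: der_bracket X eta.
  by apply: der_ext => h; rewrite !dvalE; ring.
by rewrite sigmaD sf addr0.
Qed.

Let ker_idealI : is_ideal ker_ideal.
Proof.
have [m0 mD mM] := idm.
split=> [|x y [mx sx] [my sy]|a x [mx sx]].
- by split=> // eta; rewrite scale0r.
- by split; [apply: mD | move=> eta; rewrite scalerDl sigmaD sx sy addr0].
- by split; [apply: mM | move=> eta; rewrite mulrC -scalerA].
Qed.

(** [ker_ideal] is known to be stable only under [m Der(A)]. Its saturation [J] is stable under all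
    of [Der(A)], since [u g eta(f) = (u eta)(g f) - (u eta)(g) f] for [u] in [m]. As [J] is nonzero,
    it contains [1]. *)
Lemma sigma_pow_der_eventually0 :
  exists s, forall t X, (s <= t)%N -> pow_der m t X -> sigma X = 0.
Proof.
have [nz_der|no_der] := pselect (exists eta : Der A, eta <> 0); last first.
  exists 0 => t X _ _; rewrite -[RHS]sigma0; congr sigma.
  by apply: contrapT => nzX; apply: no_der; exists X.
have [K0 KD KM] := ker_idealI.
pose J f := exists s, forall t v, (s <= t)%N -> 'm^t v -> ker_ideal (v * f).
have [] : J 1; last first.
  move=> s Js; exists s => t X le_st.
  elim=> [|{}X [f [eta [mf ->]]]|{}X Y _ IHX _ IHY]; first exact: sigma0.
    by have := Js t f le_st mf; rewrite mulr1 => -[].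
  by rewrite sigmaD IHX IHY addr0.
apply: simA.
- split=> [|x y [s1 J1] [s2 J2]|a x [s Js]].
  + by exists 0 => t v _ _; rewrite mulr0.
  + exists (maxn s1 s2) => t v; rewrite geq_max => /andP[le1 le2] mv.
    by rewrite mulrDr; apply: KD; [apply: J1 mv | apply: J2 mv].
  + by exists s => t v le_st mv; rewrite mulrCA; apply/KM/(Js t).
- move=> eta f [s Js]; exists s.+1 => -[//|t] v; rewrite ltnS => le_st.
  elim=> [|{}v [u [g [mu mg ->]]]|{}v w _ IHv _ IHw].
  + by rewrite mul0r.
  + have mue : pow_der m 1 (u *: eta) by apply: pow_der_in; apply/ideal_pow1.
    have -> : u * g * dval eta f
        = dval (u *: eta) (g * f) - dval (u *: eta) g * f.
      by rewrite !dvalE; ring.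
    apply: idealB => //.
      by apply: ker_ideal_stable => //; apply: Js mg.
    by apply: (Js t) => //; apply: pow_der1_dval_pow.
  + by rewrite mulrDl; apply: KD.
- have [f kf nz_f] := ker_ideal_exists nz_der.
  by exists f => //; exists 0 => t v _ _; apply: KM.
Qed.

(** This is the equality [W_s = W_(s+1)]. *)
Let stable s := forall X, pow_der m s X -> exists2 Y, pow_der m s.+1 Y & sigma X = sigma Y.

(** The brackets [[m^2 Der, m^s Der]] fill [m^(s+1) Der] modulo [m^(s+2) Der], so only their images
    have to be pushed down one step. *)
Let bracket_mod_stable s t : (2 < s)%N ->
  (forall Y Z, pow_der m 2 Y -> pow_der m s Z ->
     exists2 Z', pow_der m s.+2 Z' & sigma (der_bracket Y Z) = sigma Z') ->
  t = s.+1 -> stable t.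
Proof.
move=> lt2s brs -> X mX.
have [B sB mXB] := pow_der_bracket_mod idm eulE char0 lt2s mX.
have [R mR sR] : exists2 R, pow_der m s.+2 R & sigma B = sigma R.
  elim: sB {mXB} => [|{}B [Y [Z [mY mZ ->]]]|{}B Y _ [R1 mR1 s1] _ [R2 mR2 s2]].
  - by exists 0; first exact: sums0.
  - exact: brs.
  - by exists (R1 + R2); [exact: sumsD | rewrite !sigmaD s1 s2].
exists (X - B + R); first exact: sumsD.
by rewrite sigmaD sigmaB -sR subrK.
Qed.

Let sigma_bracket_eqr Y Z Z' : pow_der m 1 Y -> pow_der m 1 Z -> pow_der m 1 Z' ->
  sigma Z = sigma Z' -> sigma (der_bracket Y Z) = sigma (der_bracket Y Z').
Proof. by move=> mY mZ mZ' eZ; rewrite !sigma_bracket // eZ. Qed.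

Let sigma_bracket_eql Y Y' Z : pow_der m 1 Y -> pow_der m 1 Y' -> pow_der m 1 Z ->
  sigma Y = sigma Y' -> sigma (der_bracket Y Z) = sigma (der_bracket Y' Z).
Proof. by move=> mY mY' mZ eY; rewrite !sigma_bracket // eY. Qed.

Let pow_der_pow1 s X : (0 < s)%N -> pow_der m s X -> pow_der m 1 X.
Proof. by move=> s_gt0; apply: pow_der_le. Qed.

(** On [m Der(A)] the image of a bracket depends only on the images of its entries. Trading [Z] for
    [Z'] in [m^(s+1) Der] puts the bracket with [m^2 Der] into [m^(s+2) Der]. *)
Let stableS s : (2 < s)%N -> stable s -> stable s.+1.
Proof.
move=> lt2s sts; apply: (bracket_mod_stable lt2s) => // Y Z mY mZ.
have [Z' mZ' eZ] := sts Z mZ; exists (der_bracket Y Z').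
  exact: (@pow_der_bracket _ _ _ 1 s).
apply: sigma_bracket_eqr => //; first exact: pow_der_pow1 mY.
  by apply: pow_der_pow1 mZ; apply: leq_trans lt2s.
exact: pow_der_pow1 mZ'.
Qed.

(** In [[m^2 Der, m^3 Der]] it is now the first entry that is traded, which leads into
    [[m^3 Der, m^3 Der]], inside [m^5 Der]. This jumps over [stable 3], where [pow_der_bracket_mod]
    would be required at [s = 2]. *)
Let stable24 : stable 2 -> stable 4.
Proof.
move=> st2; apply: (@bracket_mod_stable 3) => // Y Z mY mZ.
have [Y' mY' eY] := st2 Y mY; exists (der_bracket Y' Z).
  exact: (@pow_der_bracket _ _ _ 2 2).
apply: sigma_bracket_eql eY; first exact: pow_der_pow1 mY.
  exact: pow_der_pow1 mY'.
exact: pow_der_pow1 mZ.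
Qed.

(** [ad E] is the identity on [m^2 Der / m^3 Der], and trading [E] for [E'] in [m^2 Der] sends
    [[E', X]] into [m^3 Der]. *)
Let stable12 : stable 1 -> stable 2.
Proof.
move=> st1 X mX; have mE : pow_der m 1 E by case: eulE.
have [E' mE' eE] := st1 E mE.
exists (der_bracket E' X - (der_bracket E X - (1%:R : A) *: X)).
  apply: pow_derB; first exact: (@pow_der_bracket _ _ _ 1 1).
  exact: euler_bracket.
rewrite !sigmaB (sigma_bracket_eql mE _ _ eE) ?scale1r.
- by rewrite opprB addrC subrK.
- exact: pow_der_pow1 mE'.
- exact: pow_der_pow1 mX.
Qed.

Let stable_le s t : (2 < s)%N -> (s <= t)%N -> stable s -> stable t.
Proof.
move=> lt2s /subnK <- sts; elim: (t - s)%N => // d IHd.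
by rewrite addSn; apply: stableS => //; rewrite (leq_trans lt2s) // leq_addl.
Qed.

Let stable_eventually0 s : (forall t, (s <= t)%N -> stable t) ->
  forall X, pow_der m s X -> sigma X = 0.
Proof.
move=> sts X mX; have [n sn0] := sigma_pow_der_eventually0.
have [Y mY ->] : exists2 Y, pow_der m (n + s) Y & sigma X = sigma Y.
  elim: {sn0} n => [|n [Y mY ->]]; first by exists X.
  have [Z mZ ->] := sts (n + s)%N (leq_addl _ _) Y mY.
  by exists Z.
by apply: sn0 mY; rewrite leq_addr.
Qed.

(* [ad E] is multiplication by [s - 1] on the quotient [W_s / W_{s+1}], which is
   therefore zero if [r = 1] and [s > 1]. *)
Let stable_rank1 s : r = 1%N -> (1 < s)%N -> stable s.
Proof.
case: s => [|[|s]] // r1 _ X mX.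
have mE : pow_der m 1 E by case: eulE.
pose c : k := s.+1%:R.
exists ((- c^-1)%:A *: (der_bracket E X - (s.+1%:R : A) *: X)).
  by apply: pow_derA; apply: euler_bracket.
have sEX : sigma (der_bracket E X) = 0.
  rewrite sigma_bracket //; last exact: pow_der_pow1 mX.
  move: (sigma E) (sigma X); rewrite r1 => M N.
  by apply/matrixP => i j; rewrite !mxE !big_ord_recl !big_ord0 !ord1; ring.
rewrite sigmaZ sigmaB sEX sub0r (natrA_scale A) sigmaZ scalerN scaleNr opprK scalerA.
by rewrite mulVf ?scale1r //; have /pcharf0P -> := char0.
Qed.

(** It suffices that [W_s = W_(s+1)] for all [s > r^2], because [W_s] vanishes eventually. A failure
    at [s1 > r^2] forces failures at all smaller positive indices, hence [s1] strict inclusions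
    among subspaces of a space of dimension [r^2]. *)
Lemma sigma_pow_der_eq0 X : pow_der m (r ^ 2).+1 X -> sigma X = 0.
Proof.
apply: stable_eventually0 => s1 lt_s1; apply: contrapT => ns1.
have [r0|r_gt0] := posnP r.
  by case: ns1 => Y _; exists 0; [exact: sums0 | apply/matrixP => i; have := ltn_ord i; rewrite {2}r0].
(* From [stable 1] or [stable 2] equality follows only from index [4] on. This suffices if
   [r^2 + 1 >= 5], so [r = 1] is treated apart. *)
have [r1|r_gt1] := eqVneq r 1%N.
  by case: ns1; apply: stable_rank1 => //; rewrite r1 in lt_s1.
have {}r_gt1 : (1 < r)%N by rewrite ltn_neqAle eq_sym r_gt1.
have lt4s1 : (4 < s1)%N by apply: leq_trans lt_s1; rewrite ltnS (leq_sqr 2).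
have nst s : (0 < s)%N -> (s <= s1)%N -> ~ stable s.
  case: s => [|[|[|s]]] // _ le_ss1 sts; apply: ns1.
  - by apply: (@stable_le 4) => //; [apply: ltnW | apply/stable24/stable12].
  - by apply: (@stable_le 4) => //; [apply: ltnW | apply: stable24].
  - by apply: stable_le sts.
have /choice[X' X'P] (i : 'I_s1) : exists Y, pow_der m i.+1 Y /\
    forall Z, pow_der m i.+2 Z -> sigma Y <> sigma Z.
  apply: contrapT => noY; apply: (nst i.+1) => // Y mY.
  apply: contrapT => noZ; apply: noY; exists Y; split=> // Z mZ eYZ.
  by apply: noZ; exists Z.
have [|c [[i nz_ci] c0]] := @matrices_dependent k r s1 (sigma \o X').
  by rewrite mulnn.
(* At the least index with nonzero coefficient, the relation writes [sigma (X' i0)] through later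
   terms, hence as an element of [W_(i0+2)], against the choice of [X' i0]. *)
have [i0 nz_ci0 min_i0] := @arg_minnP _ i (fun j => c j != 0) (@nat_of_ord s1) nz_ci.
case: (X'P i0) => mX' nX'.
apply: (nX' ((- (c i0)^-1)%:A *: \sum_(j | j != i0) (c j)%:A *: X' j)).
  apply: pow_derA; elim/big_ind: _ => [|Y Z|j neq_ji0]; [exact: sums0|exact: sumsD|].
  have [->|nz_cj] := eqVneq (c j) 0; first by rewrite !scale0r; apply: sums0.
  apply: pow_derA; case: (X'P j) => mX'j _; apply: pow_der_le mX'j.
  by rewrite ltnS ltn_neqAle min_i0 // andbT eq_sym.
rewrite sigmaZ (big_morph sigma sigmaD sigma0).
move: c0; rewrite (bigD1 i0) //= => /eqP; rewrite addr_eq0 => /eqP ci0.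
have -> : \sum_(j | j != i0) sigma ((c j)%:A *: X' j) = - (c i0 *: sigma (X' i0)).
  by rewrite ci0 opprK; apply: eq_bigr => j _; rewrite sigmaZ.
by rewrite scalerN scaleNr opprK scalerA mulVf ?scale1r.
Qed.

End LocalRepresentation.

(** * The coordinate ring *)

Lemma mpoly_ring_gen (k : fieldType) (n : nat) (p : {mpoly k[n]}) :
  ring_gen (fun q => (exists c, q = c%:MP) \/ (exists i, q = 'X_i)) p.
Proof.
have genC c : ring_gen (fun q : {mpoly k[n]} =>
    (exists c, q = c%:MP) \/ (exists i, q = 'X_i)) c%:MP.
  by apply: ring_gen_in; left; exists c.
elim/mpolyind: p => [|c m p _ _ IHp]; first by rewrite -(mpolyC0 n).
apply: ring_genD IHp; rewrite -mul_mpolyC; apply: ring_genM => //.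
rewrite mpolyXE_id; elim/big_ind: _ => [|x y|i _]; [by rewrite -(mpolyC1 n)|exact: ring_genM|].
elim: (m i) => [|j IHj]; first by rewrite expr0 -(mpolyC1 n).
by rewrite exprS; apply: ring_genM => //; apply: ring_gen_in; right; exists i.
Qed.

Lemma mderivXU (R : comNzRingType) (n : nat) (i j : 'I_n) :
  ('X_j : {mpoly R[n]})^`M(i) = (i == j)%:R.
Proof.
rewrite mderivX mnm1E eq_sym; case: eqP => [->|_]; last by rewrite scale0r.
rewrite scale1r -[RHS]mpolyX0; congr ('X_[_]).
by apply/mnmP => l; rewrite mnmBE subnn mnmE.
Qed.

Lemma dim_rV (k : fieldType) (n : nat) : \dim {:'rV[k]_n} = n.
Proof. by rewrite dimvf; exact: mul1n. Qed.

Lemma solution_space (k : fieldType) (m n : nat) (J : 'M[k]_(m, n)) :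
  exists K : {vspace 'rV[k]_n},
    [/\ forall v, v \in K <-> v *m J^T = 0, (n - m <= \dim K)%N &
        row_free J -> \dim K = (n - m)%N].
Proof.
pose f : 'Hom('rV[k]_n, 'rV[k]_m) := linfun (mulmxr J^T).
have dimK : (\dim (lker f) + \dim (limg f))%N = n.
  by rewrite -[RHS](dim_rV k) -(limg_ker_dim f fullv) capfv.
exists (lker f); split=> [v||freeJ].
- by rewrite memv_ker lfunE /=; split=> [/eqP|->].
- rewrite leq_subLR -{1}dimK addnC leq_add2r -[leqRHS](dim_rV k).
  exact/dimvS/subvf.
- suff imf : limg f = fullv by move: dimK; rewrite imf dim_rV => /(canRL (addnK _)).
  apply/vspaceP => u; rewrite memvf.
  have /row_fullP[B JB] : row_full J^T by rewrite /row_full mxrank_tr.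
  apply/memv_imgP; exists (u *m B); rewrite ?memvf // lfunE /=.
  by rewrite -mulmxA JB mulmx1.
Qed.

Lemma row_free_complete (k : fieldType) (c d : nat) (J : 'M[k]_(c, c + d)) :
  row_free J -> exists B : 'M[k]_(d, c + d), col_mx J B \in unitmx.
Proof.
move=> freeJ; exists (dsubmx (row_ebase J)).
rewrite -row_free_unit; apply: inj_row_free => u.
rewrite -[u]hsubmxK mul_row_col -{1}[J]mulmx_ebase (eqP freeJ) pid_mx_row.
set Q := row_ebase J; have uQ : Q \in unitmx by apply: row_ebase_unit.
have -> : dsubmx Q = row_mx 0 1%:M *m Q.
  by rewrite -{2}[Q]vsubmxK mul_row_col mul0mx mul1mx add0r.
rewrite !mulmxA -mulmxDl => /(congr1 (mulmx^~ (invmx Q))).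
rewrite mulmxK // mul0mx !mul_mx_row !mulmx0 !mulmx1 add_row_mx addr0 add0r.
rewrite -[0]row_mx0 => /eq_row_mx[uc ->].
move/(congr1 (mulmx^~ (invmx (col_ebase J)))): uc.
by rewrite mulmxK ?col_ebase_unit // mul0mx => ->.
Qed.

Section CoordinateRing.
Variables (k : closedFieldType) (n : nat) (X : set ('I_n -> k)).
Variables (A : idomainAlgType k) (phi : {lrmorphism {mpoly k[n]} -> A}).
Hypothesis phi_surj : forall a, exists p, phi p = a.
Hypothesis phi_ker : forall p, phi p = 0 <-> vanishing_ideal X p.

Lemma phiC c : phi c%:MP = c%:A.
Proof. by rewrite -alg_mpolyC linearZ rmorph1. Qed.

Lemma point_evaluation x : X x ->
  exists ev : {rmorphism A -> k}, forall p, ev (phi p) = p.@[x].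
Proof.
move=> Xx; have [s sE] := choice phi_surj.
have eqx p q : phi p = phi q -> p.@[x] = q.@[x].
  move=> epq; have /phi_ker/(_ x Xx) : phi (p - q) = 0 by rewrite rmorphB /= epq subrr.
  by rewrite mevalB => /eqP; rewrite subr_eq0 => /eqP.
pose ev a := (s a).@[x].
have evB : zmod_morphism ev.
  by move=> a b; rewrite /ev -mevalB; apply: eqx; rewrite rmorphB /= !sE.
have evM : monoid_morphism ev.
  split=> [|a b]; first by rewrite /ev -[RHS](meval1 x); apply: eqx; rewrite sE rmorph1.
  by rewrite /ev -mevalM; apply: eqx; rewrite rmorphM /= !sE.
pose mB := GRing.isZmodMorphism.Build _ _ ev evB.
pose mM := GRing.isMonoidMorphism.Build _ _ ev evM.
pose ev' : {rmorphism A -> k} := HB.pack ev mB mM.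
by exists ev' => p; apply: eqx; rewrite sE.
Qed.

Lemma eq0_at_points a :
  (forall x (ev : {rmorphism A -> k}), X x -> (forall p, ev (phi p) = p.@[x]) ->
     ev a = 0) -> a = 0.
Proof.
move=> ev0; have [p pa] := phi_surj a; rewrite -pa; apply/phi_ker => x Xx.
have [ev evE] := point_evaluation Xx.
by rewrite -evE pa; apply: ev0 evE.
Qed.

Lemma coord_ring_gen a :
  ring_gen (fun z => (exists c, z = in_alg A c) \/ z \in [seq phi 'X_i | i : 'I_n]) a.
Proof.
have [p <-] := phi_surj a.
elim: (mpoly_ring_gen p) => {p a} [q [[c ->]|[i ->]]|x y _ Gx _ Gy|x y _ Gx _ Gy].
- by apply: ring_gen_in; left; exists c; rewrite phiC.
- by apply: ring_gen_in; right; apply/mapP; exists i; rewrite ?mem_enum.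
- by rewrite rmorphD; apply: ring_genD.
- by rewrite rmorphM; apply: ring_genM.
Qed.

Lemma dval_coord (eta : Der A) p :
  dval eta (phi p) = \sum_i phi (p^`M(i)) * dval eta (phi 'X_i).
Proof.
elim: (mpoly_ring_gen p) => {p} [q [[c ->]|[j ->]]|x y _ Gx _ Gy|x y _ Gx _ Gy].
- rewrite phiC dvalC big1 // => i _.
  by rewrite mderivC rmorph0 mul0r.
- rewrite (bigD1 j) //= big1 ?addr0 => [|i neq_ij].
    by rewrite mderivXU eqxx rmorph1 mul1r.
  by rewrite mderivXU (negPf neq_ij) rmorph0 mul0r.
- rewrite rmorphD dvalDr Gx Gy -big_split; apply: eq_bigr => i _.
  by rewrite mderivD rmorphD mulrDl.
- rewrite rmorphM dvalM Gx Gy mulr_suml mulr_sumr -big_split; apply: eq_bigr => i _.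
  by rewrite mderivM rmorphD !rmorphM /=; ring.
Qed.

Lemma der_of_vector (v : 'I_n -> A) :
  (forall p, vanishing_ideal X p -> \sum_i phi (p^`M(i)) * v i = 0) ->
  exists eta : Der A, forall p, dval eta (phi p) = \sum_i phi (p^`M(i)) * v i.
Proof.
move=> v0; have [s sE] := choice phi_surj.
pose D p := \sum_i phi (p^`M(i)) * v i.
have DB p q : D (p - q) = D p - D q.
  by rewrite /D -sumrB; apply: eq_bigr => i _; rewrite mderivB rmorphB mulrBl.
have DM p q : D (p * q) = D p * phi q + phi p * D q.
  rewrite /D mulr_suml mulr_sumr -big_split; apply: eq_bigr => i _.
  by rewrite mderivM rmorphD !rmorphM /=; ring.
have eqD p q : phi p = phi q -> D p = D q.
  move=> epq; apply/eqP; rewrite -subr_eq0 -DB; apply/eqP/v0/phi_ker.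
  by rewrite rmorphB /= epq subrr.
pose eta (a : A) : A^o := D (s a).
have etaP : eta \in @der_pred _ A.
  apply/asboolP; split=> [c a b|a b].
    rewrite /eta (eqD _ (c *: s a + s b)); last by rewrite linearP /= !sE.
    rewrite /D scaler_sumr -big_split; apply: eq_bigr => i _ /=.
    by rewrite linearP linearP /= mulrDl scalerAl.
  rewrite /eta (eqD _ (s a * s b)); last by rewrite rmorphM /= !sE.
  by rewrite DM !sE.
by exists (MkDer etaP) => p; rewrite dvalK; apply: eqD; rewrite sE.
Qed.

(** First-order Taylor expansion at [x], checked on constants and variables and carried through sums
    and products. *)
Lemma taylor2 (ev : {rmorphism A -> k}) (x : 'I_n -> k) p :
  (forall q, ev (phi q) = q.@[x]) ->
  ideal_pow (fun a => ev a = 0) 2 (phi p - (p.@[x])%:A -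
    \sum_i (p^`M(i)).@[x] *: (phi 'X_i - (x i)%:A)).
Proof.
move=> evE; pose m a := ev a = 0; rewrite -/m.
have evA c : ev c%:A = c by rewrite -phiC evE mevalC.
pose L p := \sum_i (p^`M(i)).@[x] *: (phi 'X_i - (x i)%:A).
have mL q : m (L q).
  rewrite /m rmorph_sum big1 // => i _.
  have -> : (q^`M(i)).@[x] *: (phi 'X_i - (x i)%:A)
    = (q^`M(i)).@[x]%:A * (phi 'X_i - (x i)%:A) by rewrite mulr_algl.
  by rewrite rmorphM rmorphB /= evE mevalXU !evA subrr mulr0.
rewrite -/(L p).
elim: (mpoly_ring_gen p) => {p} [q [[c ->]|[j ->]]|p q _ Gp _ Gq|p q _ Gp _ Gq].
- rewrite phiC mevalC subrr sub0r /L big1 ?oppr0; first exact: ideal_pow0.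
  by move=> i _; rewrite mderivC meval0 scale0r.
- rewrite /L (bigD1 j) //= big1 => [|i neq_ij].
    rewrite mderivXU eqxx meval1 scale1r mevalXU addr0 subrr.
    exact: ideal_pow0.
  by rewrite mderivXU (negPf neq_ij) meval0 scale0r.
- have -> : L (p + q) = L p + L q.
    rewrite /L -big_split; apply: eq_bigr => i _.
    by rewrite mderivD mevalD scalerDl.
  have -> : phi (p + q) - (p + q).@[x]%:A - (L p + L q) =
      (phi p - p.@[x]%:A - L p) + (phi q - q.@[x]%:A - L q).
    rewrite rmorphD mevalD scalerDl /=.
    by move: (_ *: _) (_ *: _) (phi p) (phi q) (L p) (L q) => u v w z l l'; ring.
  exact: ideal_powD.
- have -> : L (p * q) = q.@[x] *: L p + p.@[x] *: L q.
    rewrite /L !scaler_sumr -big_split; apply: eq_bigr => i _ /=.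
    by rewrite mderivM mevalD !mevalM scalerDl !scalerA mulrC.
  have -> : phi (p * q) - (p * q).@[x]%:A - (q.@[x] *: L p + p.@[x] *: L q) =
     (phi p - p.@[x]%:A) * (phi q - q.@[x]%:A) +
     (p.@[x]%:A * (phi q - q.@[x]%:A - L q) + q.@[x]%:A * (phi p - p.@[x]%:A - L p)).
    have AM c d : (c * d)%:A = c%:A * d%:A :> A by rewrite mulr_algl scalerA.
    rewrite rmorphM mevalM /= AM -[p.@[x] *: L q]mulr_algl -[q.@[x] *: L p]mulr_algl.
    by move: (_%:A) (_%:A) (phi p) (phi q) (L p) (L q) => u v w z l l'; ring.
  apply: ideal_powD; last by apply: ideal_powD; apply: ideal_powMr.
  apply: ideal_powS; first by rewrite /m rmorphB evA evE subrr.
  apply/ideal_pow1; first exact: kernel_ideal.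
  by rewrite /m rmorphB evA evE subrr.
Qed.

End CoordinateRing.

(** * Euler fields on smooth varieties *)

Definition tangent_dim (k : fieldType) (n : nat) (X : set ('I_n -> k)) (d : nat) :=
  forall x, X x -> exists T : {vspace 'rV[k]_n},
    (forall v, v \in T <-> tangent_space X x v) /\ \dim T = d.

Section ConormalFrame.
Variables (k : closedFieldType) (c d : nat) (X : set ('I_(c + d) -> k)).
Variables (A : idomainAlgType k) (phi : {lrmorphism {mpoly k[c + d]} -> A}).
Hypothesis phi_surj : forall a, exists p, phi p = a.
Hypothesis phi_ker : forall p, phi p = 0 <-> vanishing_ideal X p.
Hypothesis dimT : tangent_dim X d.
Variables (x : 'I_(c + d) -> k) (ev : {rmorphism A -> k}).
Hypothesis evE : forall p, ev (phi p) = p.@[x].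
Variables (p : 'I_c -> {mpoly k[c + d]}) (B : 'M[k]_(d, c + d)).
Hypothesis pX : forall i, vanishing_ideal X (p i).
Hypothesis frame_unit :
  col_mx (\matrix_(i < c, j < c + d) ((p i)^`M(j)).@[x]) B \in unitmx.
Let m a := ev a = 0.

(** The upper rows are the gradients of the equations [p i], the lower ones those of the linear
    functions [t l] below. Where [Delta] does not vanish, the [t l] are local coordinates on [X]. *)
Let Mx : 'M[A]_(c + d) :=
  col_mx (\matrix_(i, j) phi ((p i)^`M(j))) (map_mx (in_alg A) B).
Let Delta : A := \det Mx.
Let delta : k := ev Delta.

Let evA a : ev a%:A = a.
Proof. by rewrite -(phiC phi) evE mevalC. Qed.

Let ev_frame y (evy : {rmorphism A -> k}) : (forall q, evy (phi q) = q.@[y]) ->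
  map_mx evy Mx = col_mx (\matrix_(i < c, j < c + d) ((p i)^`M(j)).@[y]) B.
Proof.
move=> evyE; rewrite map_col_mx; congr col_mx; apply/matrixP => i j; rewrite !mxE ?evyE //=.
by rewrite -(phiC phi) evyE mevalC.
Qed.

Let nz_delta : delta != 0.
Proof.
by rewrite /delta -det_map_mx (ev_frame evE) -unitfE -unitmxE.
Qed.

Let nz_Delta : Delta != 0.
Proof. by apply: contraNneq nz_delta => D0; rewrite /delta D0 rmorph0. Qed.

(** By Cramer's rule these are the coefficients of [Delta d/dt_l]. *)
Let v (l : 'I_d) (j : 'I_(c + d)) : A := (\adj Mx) j (rshift c l).

Let grad_v i l : \sum_j phi ((p i)^`M(j)) * v l j = 0.
Proof.
have := congr1 (fun N : 'M[A]_(c + d) => N (lshift d i) (rshift c l)) (mul_mx_adj Mx).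
rewrite [LHS]mxE [RHS]mxE eq_lrshift mulr0n => adj0; rewrite -[RHS]adj0; apply: eq_bigr => j _.
by rewrite col_mxEu mxE.
Qed.

(** After multiplication by [Delta] this is tested at points [y] of [X]. If [Delta(y) != 0], the
    gradients of the [p i] at [y] are independent, so their orthogonal space has dimension [d]; it
    contains the tangent space, of the same dimension, and therefore equals it. *)
Let v_tangent l q : vanishing_ideal X q -> \sum_j phi (q^`M(j)) * v l j = 0.
Proof.
move=> qX; apply/eqP; rewrite -(mulrI_eq0 _ (mulfI nz_Delta)); apply/eqP.
apply: (eq0_at_points phi_surj phi_ker) => y evy Xy evyE; rewrite rmorphM.
have [->|nz_Dy] := eqVneq (evy Delta) 0; first by rewrite mul0r.
have uMy : col_mx (\matrix_(i < c, j < c + d) ((p i)^`M(j)).@[y]) B \in unitmx.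
  by rewrite -(ev_frame evyE) unitmxE unitfE det_map_mx.
set J := (\matrix_(i, j) _) in uMy.
have freeJ : row_free J.
  apply: inj_row_free => u uJ0.
  have : row_mx u 0 *m col_mx J B = 0 by rewrite mul_row_col uJ0 mul0mx addr0.
  move/(congr1 (mulmx^~ (invmx (col_mx J B)))); rewrite mulmxK // mul0mx => u0.
  by have /eq_row_mx[] := etrans u0 (esym (row_mx0 _ _ _ _)).
have [K [memK _ /(_ freeJ) dimK]] := solution_space J.
have [T [memT dimTd]] := dimT Xy.
have eqTK : T = K.
  apply/eqP; rewrite eqEdim dimK dimTd addKn leqnn andbT.
  apply/subvP => w /memT Tw; apply/memK/rowP => i; rewrite !mxE -[RHS](Tw (p i) (pX i)).
  by apply: eq_bigr => j _; rewrite !mxE mulrC.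
pose w : 'rV[k]_(c + d) := \row_j evy (v l j).
have /memT/(_ q qX) : w \in T.
  have g0 i : \sum_j evy (phi ((p i)^`M(j)) * v l j) = 0.
    by rewrite -rmorph_sum grad_v rmorph0.
  rewrite eqTK; apply/memK/rowP => i; rewrite !mxE -[RHS](g0 i).
  by apply: eq_bigr => j _; rewrite !mxE rmorphM /= evyE mulrC.
move=> w0; rewrite [X in _ * X](_ : _ = 0) ?mulr0 // -[RHS]w0 rmorph_sum.
by apply: eq_bigr => j _; rewrite rmorphM /= evyE !mxE.
Qed.

Let D_exists : exists D : 'I_d -> Der A,
  forall l q, dval (D l) (phi q) = \sum_j phi (q^`M(j)) * v l j.
Proof.
have /choice[D DE] l := der_of_vector phi_surj phi_ker (@v_tangent l).
by exists D.
Qed.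

Let z j : A := phi 'X_j - (x j)%:A.
Let t l : A := \sum_j (B l j)%:A * z j.

Let mz j : m (z j).
Proof. by rewrite /m rmorphB /= evE evA mevalXU subrr. Qed.

Let mt l : m (t l).
Proof. by rewrite /m rmorph_sum big1 // => j _; rewrite rmorphM /= mz mulr0. Qed.

Let dval_z eta j : dval eta (z j) = dval eta (phi 'X_j).
Proof. by rewrite dvalBr dvalC subr0. Qed.

Let dval_t eta l : dval eta (t l) = \sum_j (B l j)%:A * dval eta (phi 'X_j).
Proof.
by rewrite dval_sumr; apply: eq_bigr => j _; rewrite dvalM dvalC mul0r add0r dval_z.
Qed.

Let adj_mul (w : 'I_(c + d) -> A) j :
  Delta * w j = \sum_i (\adj Mx) j (lshift d i) * (\sum_l phi ((p i)^`M(l)) * w l)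
    + \sum_l v l j * (\sum_i (B l i)%:A * w i).
Proof.
pose W := \col_i w i.
have := congr1 (fun N : 'cV[A]_(c + d) => N j 0) (mulmxA (\adj Mx) Mx W).
rewrite mul_adj_mx mul_scalar_mx !mxE => <-.
rewrite big_split_ord; congr (_ + _); apply: eq_bigr => i _; congr (_ * _).
  by rewrite mxE; apply: eq_bigr => l _; rewrite col_mxEu !mxE.
by rewrite mxE; apply: eq_bigr => l _; rewrite col_mxEd !mxE.
Qed.

(** For the coefficients of [eta], the gradient terms of [adj_mul] vanish, because every [p i] is
    zero in [A]. *)
Let cramer D : (forall l q, dval (D l) (phi q) = \sum_j phi (q^`M(j)) * v l j) ->
  forall eta, Delta *: eta = \sum_l dval eta (t l) *: D l.
Proof.
move=> DE eta; apply: der_ext => a; have [q <-] := phi_surj a.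
rewrite dvalZl dval_suml (dval_coord phi eta q) mulr_sumr.
transitivity (\sum_j phi (q^`M(j)) * \sum_l v l j * dval eta (t l)).
  apply: eq_bigr => j _; rewrite mulrCA; congr (_ * _).
  rewrite (adj_mul (fun i => dval eta (phi 'X_i))) big1 ?add0r => [|i _].
    by apply: eq_bigr => l _; rewrite dval_t.
  rewrite -dval_coord; have /phi_ker -> := pX i.
  by rewrite dval0r mulr0.
under eq_bigr do rewrite mulr_sumr.
rewrite exchange_big; apply: eq_bigr => l _; rewrite dvalZl DE mulr_sumr.
by apply: eq_bigr => j _; ring.
Qed.

(** [E] imitates [sum_l t_l d/dt_l] with [d/dt_l = D_l / Delta]. As [Delta] need not be invertible
    in [A], it is replaced by its value [delta] at [x]; the error lies in [m] and does not affect
    the three conditions. *)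
Lemma euler_field_of_frame : exists E : Der A, euler_field (fun a => ev a = 0) E.
Proof.
have [D DE] := D_exists; have cram := cramer DE.
have idm : is_ideal m := kernel_ideal ev.
pose E := (delta^-1)%:A *: \sum_l t l *: D l; exists E; rewrite -/m.
have DX l j : dval (D l) (phi 'X_j) = v l j.
  rewrite DE (bigD1 j) //= big1 => [|i neq_ij].
    by rewrite mderivXU eqxx rmorph1 mul1r addr0.
  by rewrite mderivXU (negPf neq_ij) rmorph0 mul0r.
have mDd : m (delta%:A - Delta) by rewrite /m rmorphB evA subrr.
have deltaK a : (delta^-1)%:A * (delta%:A * a) = a :> A.
  by rewrite !mulr_algl scalerA mulVf // scale1r.
have mE : pow_der m 1 E.
  apply/pow_derA/sums_big => l.
  by apply: pow_der_in; apply/ideal_pow1.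
split=> //.
- move=> f; have [q <-] := phi_surj f; rewrite /m evE => qx0.
  (* Subtracting the value at [x] gives a claim about all polynomials, open to induction on their
     construction. *)
  suff : ideal_pow m 2 (dval E (phi q) - (phi q - q.@[x]%:A)).
    by rewrite qx0 scale0r subr0.
  elim: (mpoly_ring_gen q) => {qx0} {q} [q [[a ->]|[j ->]]|q q' _ IHq _ IHq'|q q' _ IHq _ IHq'].
  + by rewrite phiC dvalC mevalC !subrr; apply: ideal_pow0.
  + rewrite mevalXU -/(z j) /E dvalZl dval_suml.
    have -> : (delta^-1)%:A * \sum_l dval (t l *: D l) (phi 'X_j) - z j =
       (delta^-1)%:A * (- ((delta%:A - Delta) * z j)
        - \sum_i (\adj Mx) j (lshift d i) * (\sum_l phi ((p i)^`M(l)) * z l)).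
      transitivity ((delta^-1)%:A * (\sum_l v l j * t l - delta%:A * z j)).
        rewrite mulrBr deltaK; congr (_ * _ - _).
        by apply: eq_bigr => l _; rewrite dvalZl DX mulrC.
      have Dz := adj_mul z j; congr (_ * _).
      transitivity (Delta * z j - delta%:A * z j -
        \sum_i (\adj Mx) j (lshift d i) * (\sum_l phi ((p i)^`M(l)) * z l)).
        by rewrite Dz [RHS]addrAC [X in _ = X - _]addrAC subrr add0r.
      by move: (\sum_i _) => w; ring.
    apply: ideal_powMr; apply: ideal_powB.
      apply: ideal_powN; apply: ideal_powS => //.
      by apply/ideal_pow1.
    elim/big_ind: _ => [|a b|i _]; [exact: ideal_pow0|exact: ideal_powD|].
    apply: ideal_powMr.
    (* Since [p i] is zero in [A], its linear part at [x] lies in [m^2] by [taylor2]; freezing the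
       gradient at [x] costs another element of [m^2]. *)
    have -> : \sum_l phi ((p i)^`M(l)) * z l =
      \sum_l (phi ((p i)^`M(l)) - ((p i)^`M(l)).@[x]%:A) * z l
       - (phi (p i) - (p i).@[x]%:A - \sum_l ((p i)^`M(l)).@[x] *: z l).
      have /phi_ker pi0 := pX i; rewrite pi0 -[(p i).@[x]]evE pi0 rmorph0 scale0r.
      rewrite subr0 sub0r opprK -big_split; apply: eq_bigr => l _ /=.
      by rewrite mulrBl mulr_algl subrK.
    apply: ideal_powB; last exact: taylor2.
    elim/big_ind: _ => [|a b|l _]; [exact: ideal_pow0|exact: ideal_powD|].
    apply: ideal_powS; last by apply/ideal_pow1.
    by rewrite /m rmorphB evA evE subrr.
  + have -> : dval E (phi (q + q')) - (phi (q + q') - (q + q').@[x]%:A) =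
        (dval E (phi q) - (phi q - q.@[x]%:A)) + (dval E (phi q') - (phi q' - q'.@[x]%:A)).
      rewrite rmorphD dvalDr mevalD scalerDl /=.
      by move: (_ *: _) (_ *: _) (phi q) (phi q') (dval _ _) (dval _ _) => u w a b l l'; ring.
    exact: ideal_powD.
  + have -> : dval E (phi (q * q')) - (phi (q * q') - (q * q').@[x]%:A) =
        (phi q - q.@[x]%:A) * (phi q' - q'.@[x]%:A) +
        (phi q * (dval E (phi q') - (phi q' - q'.@[x]%:A)) +
         phi q' * (dval E (phi q) - (phi q - q.@[x]%:A))).
      have AM a b : (a * b)%:A = a%:A * b%:A :> A by rewrite mulr_algl scalerA.
      rewrite rmorphM dvalM mevalM AM /=.
      by move: (_%:A) (_%:A) (phi q) (phi q') (dval _ _) (dval _ _) => u w a b l l'; ring.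
    apply: ideal_powD; last by apply: ideal_powD; apply: ideal_powMr.
    apply: ideal_powS; first by rewrite /m rmorphB evA evE subrr.
    by apply/ideal_pow1 => //; rewrite /m rmorphB evA evE subrr.
- move=> eta.
  (* In [[t_l D_l, eta] = t_l [D_l, eta] - eta(t_l) D_l] the last terms add up to [- Delta eta] by
     [cramer]. *)
  have -> : eta + der_bracket E eta = (delta^-1)%:A *: ((delta%:A - Delta) *: eta
     + \sum_l t l *: der_bracket (D l) eta).
    rewrite scalerBl cram.
    apply: der_ext => f; rewrite dvalDl dval_bracket /E !dvalZl !dvalDl dvalNl !dvalZl.
    rewrite mulrDr mulrBr deltaK !dval_suml dvalM dvalC mul0r add0r dval_sumr.
    rewrite -!addrA -mulrBr -mulrN -mulrDr; congr (_ + _ * _).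
    rewrite -!sumrN -!big_split; apply: eq_bigr => l _ /=.
    by rewrite !dvalE; ring.
  apply/pow_derA/sumsD; first by apply/pow_der_in/ideal_pow1.
  apply: sums_big => l; apply: pow_der_in; exact/ideal_pow1.
Qed.

End ConormalFrame.

(** While there are fewer than [n - dim T] gradients, their orthogonal space is too large to lie in
    [T]. A vector [v] of it outside [T] is detected by some [q] in the ideal, whose gradient is then
    independent of the others. *)
Lemma independent_conormals (k : fieldType) (n : nat) (X : set ('I_n -> k))
    (x : 'I_n -> k) (T : {vspace 'rV[k]_n}) (m : nat) :
  (forall v, v \in T <-> tangent_space X x v) -> (m + \dim T <= n)%N ->
  exists p : 'I_m -> {mpoly k[n]}, (forall i, vanishing_ideal X (p i)) /\
    row_free (\matrix_(i < m, j < n) ((p i)^`M(j)).@[x]).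
Proof.
move=> memT; elim: m => [_|m IHm le_mn].
  exists (fun=> 0); split=> [[]//|]; apply: inj_row_free => u _.
  by apply/rowP => -[].
have [|p [pX freeJ]] := IHm; first exact: ltnW.
set J := (\matrix_(i, j) _) in freeJ.
have [K [memK leK _]] := solution_space J.
have /subvPn[v Kv Tv] : ~~ (K <= T)%VS.
  apply/negP => /dimvS; rewrite leqNgt => /negP; apply.
  by apply: leq_trans leK; rewrite ltn_subRL.
have [q qX nz_qv] : exists2 q, vanishing_ideal X q &
    \sum_(i < n) (q^`M(i)).@[x] * v 0 i != 0.
  apply: contrapT => noq; move/negP: Tv; apply; apply/memT => q qX.
  by apply/eqP/negP => /negP nz; apply: noq; exists q.
exists (fun i => oapp p q (unlift ord0 i)); split=> [i|].
  by case: (unlift ord0 i) => [j|] /=; [exact: pX | exact: qX].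
set J' := (\matrix_(i, j) _).
have J'v (u : 'rV_m.+1) : u *m J' *m v^T =
    (u 0 ord0 * \sum_(i < n) (q^`M(i)).@[x] * v 0 i)%:M + (\row_i u 0 (lift ord0 i)) *m (J *m v^T).
  rewrite -mulmxA; apply/rowP => j; rewrite !mxE !ord1 /= mulr1n big_ord_recl !mxE; congr (_ * _ + _).
    by apply: eq_bigr => i _; rewrite !mxE unlift_none.
  apply: eq_bigr => l _; rewrite !mxE; congr (_ * _).
  by apply: eq_bigr => i _; rewrite !mxE liftK.
apply: inj_row_free => u uJ0.
have Jv : J *m v^T = 0 by rewrite -[J]trmxK -trmx_mul; move/memK: Kv => ->; rewrite trmx0.
have u0 : u 0 ord0 = 0.
  have := J'v u; rewrite uJ0 mul0mx Jv mulmx0 addr0 => /rowP/(_ 0).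
  by rewrite !mxE mulr1n => /esym/eqP; rewrite mulf_eq0 (negPf nz_qv) orbF => /eqP.
have uJ : (\row_i u 0 (lift ord0 i)) *m J = 0.
  rewrite -[RHS]uJ0; apply/rowP => j; rewrite !mxE big_ord_recl u0 mul0r add0r.
  by apply: eq_bigr => i _; rewrite !mxE liftK.
have /rowP u'0 : \row_i u 0 (lift ord0 i) = 0.
  by apply: (row_free_inj freeJ); rewrite mul0mx.
apply/rowP => i; rewrite [RHS]mxE.
have [j ->|->] := unliftP ord0 i; last exact: u0.
by have := u'0 j; rewrite !mxE.
Qed.

Lemma euler_field_exists (k : closedFieldType) (n : nat) (X : set ('I_n -> k))
    (A : idomainAlgType k) (phi : {lrmorphism {mpoly k[n]} -> A}) (d : nat)
    (x : 'I_n -> k) (ev : {rmorphism A -> k}) :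
  (forall a, exists p, phi p = a) -> (forall p, phi p = 0 <-> vanishing_ideal X p) ->
  tangent_dim X d -> X x -> (forall p, ev (phi p) = p.@[x]) ->
  exists E : Der A, euler_field (fun a => ev a = 0) E.
Proof.
move=> phi_surj phi_ker dimT Xx evE.
have [T [memT dT]] := dimT x Xx.
have le_dn : (d <= n)%N by rewrite -dT -[leqRHS](dim_rV k); apply/dimvS/subvf.
move: (n - d)%N (esym (subnK le_dn)) => c Dn; subst n.
have [|p [pX freeJ]] := @independent_conormals _ _ X x T c memT; first by rewrite dT.
have [B uB] := row_free_complete freeJ.
exact: euler_field_of_frame pX uB.
Qed.

(** A proper stable ideal [J] vanishes at some point by the Nullstellensatz. If [J] lies in [m^s]
    with [s > 0], then for [f] in [J] the element [E(f)] of [m J] lies in [m^(s+1)], yet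
    [E(f) = s f] modulo [m^(s+1)]; so [J] lies in [m^(s+1)]. Krull's theorem yields [J = 0]. *)
Lemma der_simple_coordinate_ring (k : closedFieldType) (n : nat)
    (X : set ('I_n -> k)) (A : idomainAlgType k)
    (phi : {lrmorphism {mpoly k[n]} -> A}) (d : nat) :
  [pchar k] =i pred0 -> zariski_closed X ->
  (forall a, exists p, phi p = a) -> (forall p, phi p = 0 <-> vanishing_ideal X p) ->
  tangent_dim X d -> der_simple A.
Proof.
move=> char0 [S XS] phi_surj phi_ker dimT J idJ stJ [f Jf nz_f].
apply: contrapT => J1; case/eqP: nz_f.
have gen_A := coord_ring_gen phi_surj.
have [ev [evA evJ]] := nullstellensatz gen_A idJ J1.
pose x i := ev (phi 'X_i).
have evE p : ev (phi p) = p.@[x].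
  elim: (mpoly_ring_gen p) => {p} [q [[c ->]|[i ->]]|p q _ Gp _ Gq|p q _ Gp _ Gq].
  - by rewrite phiC mevalC; apply: evA.
  - by rewrite mevalXU.
  - by rewrite !rmorphD /= Gp Gq.
  - by rewrite !rmorphM /= Gp Gq.
have Xx : X x.
  rewrite XS => p Sp; rewrite -evE (_ : phi p = 0) ?rmorph0 //.
  by apply/phi_ker => y; rewrite XS; apply.
have [E eulE] := euler_field_exists phi_surj phi_ker dimT Xx evE.
apply: (krull_intersection gen_A evA) => s.
elim: s f Jf => [//|s IHs] f Jf.
case: s => [|s] in IHs *.
  by apply/ideal_pow1; [exact: kernel_ideal | exact: evJ].
have sf : ideal_pow (fun a => ev a = 0) s.+2 (s.+1%:R * f).
  have -> : s.+1%:R * f = dval E f - (dval E f - s.+1%:R * f) by ring.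
  apply: ideal_powB; last by apply: euler_pow => //; apply: IHs.
  case: eulE => mE _ _.
  elim: mE => [|_ [u [eta [mu ->]]]|Y Z _ IHY _ IHZ].
  - by rewrite dval0l; apply: ideal_pow0.
  - rewrite dvalZl; apply: (@ideal_pow_mul _ _ 1 s.+1) => //.
    exact/IHs/stJ.
  - by rewrite dvalDl; apply: ideal_powD.
have -> : f = (s.+1%:R^-1)%:A * (s.+1%:R * f).
  rewrite (natrA_scale A) !mulr_algl scalerA mulVf ?scale1r //.
  by have /pcharf0P -> := char0.
exact: ideal_powMr.
Qed.

(** * Finite modules *)

(** A generator joins [b] if it is independent of those kept so far; otherwise the coefficient in
    its relation is multiplied into the common denominator [g]. *)
Lemma free_submodule (A : idomainType) (M : lmodType A) (n : nat) (e : 'I_n -> M) :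
  exists (r : nat) (b : 'I_r -> M) (g : A),
    [/\ g != 0, forall a : 'I_r -> A, \sum_j a j *: b j = 0 -> forall j, a j = 0 &
        forall i, exists a : 'I_r -> A, g *: e i = \sum_j a j *: b j].
Proof.
elim: n e => [|n IHn] e.
  by exists 0, (fun=> 0), 1; split=> [|a _ []|[]] //; apply: oner_neq0.
have [r [b [g [nz_g free_b gen_b]]]] := IHn (fun i => e (lift ord0 i)).
have [[a0 [nz_a0 [a a0e]]]|indep] :=
    pselect (exists a0, a0 != 0 /\ exists a, a0 *: e ord0 = \sum_j a j *: b j).
  exists r, b, (a0 * g); split=> [|//|i]; first exact: mulf_neq0.
  have [i' ->|->] := unliftP ord0 i; last first.
    exists (fun j => g * a j); rewrite mulrC -scalerA a0e scaler_sumr.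
    by apply: eq_bigr => j _; rewrite scalerA.
  have [a' ga'] := gen_b i'; exists (fun j => a0 * a' j).
  rewrite -scalerA ga' scaler_sumr; apply: eq_bigr => j _.
  by rewrite scalerA.
pose b' (j : 'I_r.+1) := oapp b (e ord0) (unlift ord0 j).
have sumE (a : 'I_r.+1 -> A) : \sum_j a j *: b' j =
    a ord0 *: e ord0 + \sum_j a (lift ord0 j) *: b j.
  rewrite big_ord_recl /b' unlift_none /=; congr (_ + _).
  by apply: eq_bigr => j _; rewrite liftK.
exists r.+1, b', g; split=> // [a|i].
  rewrite sumE => a0.
  have a00 : a ord0 = 0.
    apply/eqP/negP => /negP nz_a0; apply: indep; exists (a ord0); split=> //.
    exists (fun j => - a (lift ord0 j)).
    move/eqP: a0; rewrite addr_eq0 => /eqP ->; rewrite -sumrN.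
    by apply: eq_bigr => j _; rewrite scaleNr.
  move: a0; rewrite a00 scale0r add0r => /free_b al0 j.
  by have [j' ->|->] := unliftP ord0 j.
have [i' ->|->] := unliftP ord0 i.
  have [a ga] := gen_b i'; exists (fun j => oapp a 0 (unlift ord0 j)).
  rewrite sumE unlift_none /= scale0r add0r ga.
  by apply: eq_bigr => j _; rewrite liftK.
exists (fun j => if unlift ord0 j is Some _ then 0 else g).
rewrite sumE unlift_none /= big1 ?addr0 // => j _.
by rewrite liftK scale0r.
Qed.

Section Coordinates.
Variables (A : idomainType) (M : lmodType A) (r : nat) (b : 'I_r -> M) (g : A).
(** The fractions [c x j / g] are the coordinates of [x] over the fraction field. *)
Variable (c : M -> 'I_r -> A).
Hypotheses (nz_g : g != 0)
  (free_b : forall a : 'I_r -> A, \sum_j a j *: b j = 0 -> forall j, a j = 0)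
  (cE : forall x, g *: x = \sum_j c x j *: b j).

Lemma coord_unique x (a : 'I_r -> A) : g *: x = \sum_j a j *: b j ->
  forall j, c x j = a j.
Proof.
rewrite cE => /eqP; rewrite -subr_eq0 -sumrB => /eqP ca0 j; apply/eqP.
rewrite -subr_eq0; apply/eqP; apply: (free_b (a := fun j => c x j - a j)).
by rewrite -[RHS]ca0; apply: eq_bigr => i _; rewrite scalerBl.
Qed.

Lemma coord_lin a x y j : c (a *: x + y) j = a * c x j + c y j.
Proof.
apply: (coord_unique (a := fun j => a * c x j + c y j)).
rewrite scalerDr scalerA mulrC -scalerA !cE scaler_sumr -big_split.
by apply: eq_bigr => i _ /=; rewrite scalerDl scalerA.
Qed.

Lemma coordD x y j : c (x + y) j = c x j + c y j.
Proof. by have := coord_lin 1 x y j; rewrite scale1r mul1r. Qed.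
Lemma coord0 j : c 0 j = 0.
Proof. by apply: (addrI (c 0 j)); rewrite -coordD !addr0. Qed.
Lemma coordZ a x j : c (a *: x) j = a * c x j.
Proof. by rewrite -[a *: x]addr0 coord_lin coord0 addr0. Qed.
Lemma coordB x y j : c (x - y) j = c x j - c y j.
Proof. by rewrite coordD -scaleN1r coordZ mulN1r. Qed.
Lemma coord_sum (I : finType) (F : I -> M) j : c (\sum_i F i) j = \sum_i c (F i) j.
Proof. exact: (big_morph (c^~ j) (fun x y => coordD x y j) (coord0 j)). Qed.

Lemma coord_basis i j : c (b i) j = g *+ (i == j).
Proof.
apply: (coord_unique (a := fun j => g *+ (i == j))).
rewrite (bigD1 i) //= eqxx big1 ?addr0 // => l neq_li.
by rewrite eq_sym (negPf neq_li) scale0r.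
Qed.

Local Notation F := {fraction A}.

Let nz_gF : tofrac g != 0.
Proof. by rewrite tofrac_eq0. Qed.

(** Uniqueness of coefficients is detected by the functionals [l j] that the balanced maps [B j]
    induce on the tensor product. *)
Lemma frac_tensor_basis : is_basis (fun i => tensor 1 (b i)).
Proof.
have [tDl tDr tA] := tensor_balanced M.
pose B j (x : F) (y : M) : F := x * tofrac (c y j) / tofrac g.
have balB j : balanced (B j).
  split=> [x y z|x y z|x a y]; rewrite /B.
  - by rewrite !mulrDl.
  - by rewrite coordD rmorphD mulrDr mulrDl.
  - by rewrite coordZ rmorphM mulrA.
have /choice[l lE] j := tensor_universal (balB j).
have lB j (a : 'I_r -> F) : l j (\sum_i a i *: tensor 1 (b i)) = a j.
  rewrite raddf_sum (bigD1 j) //= big1 ?addr0 => [|i neq_ij].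
    by rewrite tensor_scale mulr1 lE /B coord_basis eqxx mulfK.
  by rewrite tensor_scale mulr1 lE /B coord_basis (negPf neq_ij) rmorph0 mulr0 mul0r.
move=> v; suff [a va] : exists a : 'I_r -> F, v = \sum_i a i *: tensor 1 (b i).
  exists (\row_i a i); split=> [|a' va'].
    by rewrite va; apply: eq_bigr => i _; rewrite mxE.
  by apply/rowP => j; rewrite mxE -(lB j a) -va va' lB.
have [s ->] := tensor_generates v; elim: s => [|[x y] s [a IHs]].
  by exists (fun=> 0); rewrite big_nil big1 // => i _; rewrite scale0r.
exists (fun j => x / tofrac g * tofrac (c y j) + a j).
rewrite big_cons IHs.
have -> : tensor x y = \sum_j (x / tofrac g * tofrac (c y j)) *: tensor 1 (b j).
  rewrite -{1}[x](divfK nz_gF) tA cE.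
  have t0 : tensor (x / tofrac g) (0 : M) = 0.
    by apply: (addrI (tensor (x / tofrac g) 0)); rewrite -tDr !addr0.
  rewrite (big_morph (tensor (x / tofrac g)) (tDr _) t0).
  by apply: eq_bigr => j _; rewrite -tA tensor_scale mulr1.
by rewrite -big_split; apply: eq_bigr => j _ /=; rewrite scalerDl.
Qed.

End Coordinates.

Lemma basis_size_le (F : fieldType) (V : lmodType F) (m n : nat)
    (e : 'I_m -> V) (f : 'I_n -> V) : is_basis e -> is_basis f -> (m <= n)%N.
Proof.
move=> be bf.
have /choice[P PE] i : exists a : 'rV_n, e i = \sum_j a 0 j *: f j.
  by have [a []] := bf (e i); exists a.
have /choice[Q QE] i : exists a : 'rV_m, f i = \sum_j a 0 j *: e j.
  by have [a []] := be (f i); exists a.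
apply: (@mulmx1_min _ _ _ (\matrix_i P i) (\matrix_i Q i)).
apply/row_matrixP => i; have [a [_ ua]] := be (e i).
transitivity a; [apply/esym|]; apply: ua; last first.
  rewrite (bigD1 i) //= !mxE eqxx scale1r big1 ?addr0 // => j neq_ji.
  by rewrite !mxE eq_sym (negPf neq_ji) scale0r.
rewrite PE; under eq_bigr do rewrite QE scaler_sumr.
rewrite exchange_big; apply: eq_bigr => l _ /=.
rewrite !mxE scaler_suml; apply: eq_bigr => j _.
by rewrite !mxE scalerA.
Qed.

Lemma dimension_basis (F : fieldType) (V : lmodType F) (n : nat) (e : 'I_n -> V) :
  is_basis e -> dimension V = n.
Proof.
move=> be; have [f bf] : [set m | exists f : 'I_m -> V, is_basis f]%classic (dimension V).
  by apply: xgetPex; exists n, e.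
by apply/eqP; rewrite eqn_leq (basis_size_le bf be) (basis_size_le be bf).
Qed.

Section AVModuleTheory.
Variables (k : closedFieldType) (A : idomainAlgType k) (M : lmodType A).
Variable act : AV_module M.

Lemma av_actDr eta x y : act eta (x + y) = act eta x + act eta y.
Proof. by have := av_act_linearr act eta 1 x y; rewrite !scale1r. Qed.
Lemma av_act0r eta : act eta 0 = 0.
Proof. by apply: (addrI (act eta 0)); rewrite -av_actDr !addr0. Qed.
Lemma av_actM eta a x : act eta (a *: x) = dval eta a *: x + a *: act eta x.
Proof. by rewrite dvalK; apply: av_act_leibniz. Qed.
Lemma av_act_sumr eta (I : finType) (F : I -> M) :
  act eta (\sum_i F i) = \sum_i act eta (F i).
Proof. exact: (big_morph (act eta) (av_actDr eta) (av_act0r eta)). Qed.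

Lemma coordinate_system : finitely_generated M ->
  exists (r : nat) (b : 'I_r -> M) (g : A) (c : M -> 'I_r -> A),
    [/\ g != 0, forall a : 'I_r -> A, \sum_j a j *: b j = 0 -> forall j, a j = 0 &
        forall x, g *: x = \sum_j c x j *: b j].
Proof.
move=> [n [e gen_e]]; have [r [b [g [nz_g free_b gen_b]]]] := free_submodule e.
have /choice[h hE] := gen_b.
have /choice[c cE] x : exists a : 'I_r -> A, g *: x = \sum_j a j *: b j.
  have [a ->] := gen_e x; exists (fun j => \sum_i a i * h i j).
  rewrite scaler_sumr; under [RHS]eq_bigr do rewrite scaler_suml.
  rewrite exchange_big; apply: eq_bigr => i _ /=.
  rewrite scalerA mulrC -scalerA hE scaler_sumr; apply: eq_bigr => j _.
  by rewrite scalerA.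
by exists r, b, g, c.
Qed.

(* The annihilator of the torsion submodule is a nonzero [Der A]-stable ideal. *)
Lemma av_torsion_free : der_simple A -> finitely_generated M ->
  forall (a : A) (x : M), a != 0 -> a *: x = 0 -> x = 0.
Proof.
move=> simA /coordinate_system[r [b [g [c [nz_g free_b cE]]]]].
pose T x := exists2 a : A, a != 0 & a *: x = 0 :> M.
pose J f := forall x, T x -> f *: x = 0 :> M.
have TV eta x : T x -> T (act eta x).
  move=> [a nz_a ax0]; exists (a * a); first exact: mulf_neq0.
  have : dval eta a *: x + a *: act eta x = 0 by rewrite -av_actM ax0 av_act0r.
  move/(congr1 ( *:%R a)); rewrite scalerDr scaler0 [X in X + _]scalerA mulrC.
  by rewrite -[X in X + _]scalerA ax0 scaler0 add0r scalerA.
suff J1 : J 1 by move=> a x nz_a ax0; rewrite -[x]scale1r; apply: J1; exists a.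
apply: simA.
- split=> [x _|f h Jf Jh x Tx|a f Jf x Tx]; first by rewrite scale0r.
    by rewrite scalerDl Jf // Jh // addr0.
  by rewrite -scalerA Jf // scaler0.
- move=> eta f Jf x Tx; have := av_actM eta f x.
  by rewrite Jf // av_act0r Jf ?addr0 //; exact: TV.
- exists g => // x [a nz_a ax0]; rewrite cE big1 // => j _.
  have := coordZ free_b cE a x j; rewrite ax0 (coord0 free_b cE).
  by move/esym/eqP; rewrite mulf_eq0 (negPf nz_a) /= => /eqP ->; rewrite scale0r.
Qed.

End AVModuleTheory.

(** * The representation on a generic fibre *)

Section FibreRepresentation.
Variables (k : closedFieldType) (A : idomainAlgType k) (M : lmodType A).
Variables (act : AV_module M) (ev : {rmorphism A -> k}) (E : Der A).
Hypothesis char0 : [pchar k] =i pred0.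
Hypothesis evC : forall a, ev a%:A = a.
Let m (f : A) := ev f = 0.
Hypothesis eulE : euler_field m E.
Hypothesis simA : der_simple A.
Variables (r : nat) (b : 'I_r -> M) (g : A) (c : M -> 'I_r -> A).
Hypotheses (nz_evg : ev g != 0)
  (free_b : forall a : 'I_r -> A, \sum_j a j *: b j = 0 -> forall j, a j = 0)
  (cE : forall x, g *: x = \sum_j c x j *: b j).

(** Coordinates of the class of [x] in the fibre of [M] at a point where [g] does not vanish. *)
Let lam (x : M) (j : 'I_r) : k := ev (c x j) / ev g.
Let sigma (X : Der A) : 'M[k]_r := \matrix_(i, j) lam (act X (b i)) j.

Let lamB x y j : lam (x - y) j = lam x j - lam y j.
Proof. by rewrite /lam (coordB free_b cE) rmorphB mulrBl. Qed.

(** For [X] in [m Der(A)] the Leibniz terms [X(f)] vanish at the point, so [X] induces a linear map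
    of the fibre; the formula comes from applying [X] to [g x = sum_i c_i(x) b_i]. *)
Let lam_act X x j : pow_der m 1 X -> lam (act X x) j = \sum_i lam x i * sigma X i j.
Proof.
move=> mX.
have evX f : ev (dval X f) = 0.
  by apply/(ideal_pow1 (kernel_ideal ev)); apply: pow_der_dval.
have := congr1 (fun y => ev (c y j)) (av_actM act X g x).
rewrite /= (coordD free_b cE) !(coordZ free_b cE) rmorphD !rmorphM evX mul0r add0r.
rewrite cE av_act_sumr (coord_sum free_b cE) rmorph_sum => e.
apply: (mulfI nz_evg); rewrite /lam mulrA -e mulr_suml mulr_sumr; apply: eq_bigr => i _.
rewrite av_actM (coordD free_b cE) !(coordZ free_b cE) rmorphD !rmorphM evX mul0r add0r.
by rewrite mxE /lam; field.
Qed.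

Lemma coord_act_vanish X x j : pow_der m (r ^ 2).+1 X -> ev (c (act X x) j) = 0.
Proof.
move=> mX; suff sX : sigma X = 0.
  have := lam_act x j (pow_der_le (ltn0Sn _) mX).
  rewrite sX big1 => [|i _]; last by rewrite mxE mulr0.
  by move/eqP; rewrite mulf_eq0 invr_eq0 (negPf nz_evg) orbF => /eqP.
apply: (sigma_pow_der_eq0 char0 evC eulE simA) mX => [a Y Z|Y Z mY mZ].
  apply/matrixP => i l; rewrite !mxE /lam av_act_linearl (coord_lin free_b cE).
  by rewrite rmorphD rmorphM evC mulrDl mulrA.
apply/matrixP => i l; rewrite !mxE av_act_bracket lamB !lam_act //.
by congr (_ - _); apply: eq_bigr => i' _; rewrite !mxE.
Qed.

End FibreRepresentation.

(** * Iterated commutators evaluated at a point *)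

Section DiffopLemmas.
Variables (k : fieldType) (A : comAlgType k).

Lemma foldl_op_comm_comp (P Q R : lmodType A) (h : Q -> R) (phi : P -> Q) fs x :
  (forall a y z, h (y - a *: z) = h y - a *: h z) ->
  foldl (@op_comm k A P R) (h \o phi) fs x = h (foldl (@op_comm k A P Q) phi fs x).
Proof.
move=> hB; elim: fs phi => //= f fs IHfs phi.
rewrite -IHfs; congr (foldl _ _ _ _); apply/funext => y.
by rewrite /op_comm /= hB.
Qed.

Lemma op_comm_k_linear (P Q : lmodType A) (phi : P -> Q) f :
  k_linear phi -> k_linear (op_comm phi f).
Proof.
move=> linphi c x y; rewrite /op_comm scalerDr scalerA mulrC -scalerA !linphi.
rewrite scalerDr scalerBr opprD addrACA; congr (_ - _ + _).
by rewrite !scalerA mulrC.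
Qed.

(** Evaluation turns the outer factor [f] of a commutator into the scalar [ev f], which can be moved
    inside by linearity over [k]. Each commutator thus becomes a factor [f - ev f] in the
    argument. *)
Lemma eval_foldl_op_comm (P : lmodType A) (psi : P -> A^o) (ev : {rmorphism A -> k})
    (fs : seq A) x : k_linear psi -> (forall c, ev c%:A = c) ->
  ev (foldl (@op_comm k A P A^o) psi fs x) =
  ev (psi ((\prod_(f <- fs) (f - (ev f)%:A)) *: x)).
Proof.
move=> + evC; elim: fs psi x => [|f fs IHfs] psi x linpsi.
  by rewrite big_nil scale1r.
rewrite /= IHfs; last exact: op_comm_k_linear.
rewrite big_cons -scalerA; set y := _ *: x.
have -> : (f - (ev f)%:A) *: y = (- ev f)%:A *: y + f *: y.
  by rewrite scalerBl scaleNr scaleNr addrC.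
rewrite linpsi /op_comm.
change (ev ((psi (f *: y) : A) - f * psi y) = ev ((- ev f)%:A * (psi y : A) + psi (f *: y))).
by rewrite rmorphB rmorphD !rmorphM evC mulNr addrC.
Qed.

End DiffopLemmas.

Theorem theorem5p5 (k : closedFieldType) (char0 : [pchar k]%R =i pred0)
    (n : nat) (X : set ('I_n -> k))
    (X_irr : irreducible_affine_variety X) (X_smooth : smooth X)
    (A : idomainAlgType k) (A_coord : is_coordinate_ring X A)
    (M : lmodType A) (act : AV_module M) (M_fin : finitely_generated M) :
  is_diffop (rank M ^ 2) (rho act).
Proof.
have [phi [phi_surj phi_ker]] := A_coord.
have [d [_ dimT]] := X_smooth.
have simA : der_simple A.
  by apply: der_simple_coordinate_ring phi_surj phi_ker dimT => //; case: X_irr.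
have [r [b [g [c [nz_g free_b cE]]]]] := coordinate_system M_fin.
have -> : rank M = r by apply: dimension_basis (frac_tensor_basis nz_g free_b cE).
have tf := av_torsion_free act simA M_fin.
split=> [a Y Z|fs Y].
  by apply/val_inj/funext => x; apply: av_act_linearl.
apply/val_inj/funext => x /=.
pose evx (D : At M) : M := D x.
rewrite -[LHS]/(evx _) -foldl_op_comm_comp // /comp /evx /=.
(* As [M] is torsion-free, the coordinates [c _ j] decide whether an element vanishes. *)
apply: (tf g _ nz_g); rewrite cE big1 // => j _.
rewrite (_ : c _ j = 0) ?scale0r //; set Dx := foldl _ _ _ _.
(* The extra factor [g] disposes of the points where [g] vanishes and the fibre is not
   controlled. *)
suff : g * c Dx j = 0 by move/eqP; rewrite mulf_eq0 (negPf nz_g) => /eqP.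
apply: (eq0_at_points phi_surj phi_ker) => y ev Xy evE; rewrite rmorphM.
have [->|nz_evg] := eqVneq (ev g) 0; first by rewrite mul0r.
have evC a : ev a%:A = a by rewrite -(phiC phi) evE mevalC.
have [E eulE] := euler_field_exists phi_surj phi_ker dimT Xy evE.
pose psi (Y : Der A) : A^o := c (act Y x) j.
have -> : c Dx j = foldl (@op_comm k A _ A^o) psi fs Y.
  rewrite /Dx -(foldl_op_comm_comp (h := fun z => c z j : A^o)) // => a z w.
  by rewrite (coordB free_b cE) (coordZ free_b cE).
rewrite eval_foldl_op_comm //; last first.
  by move=> a Z W; rewrite /psi av_act_linearl (coord_lin free_b cE).
rewrite /psi (coord_act_vanish act char0 evC eulE simA nz_evg free_b cE) ?mulr0 //.
(* The [r^2 + 1] commutators give a product of [r^2 + 1] elements of [m], exactly the power that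
   [coord_act_vanish] requires. *)
have prod_pow (s : seq A) :
    ideal_pow (fun a => ev a = 0) (size s) (\prod_(f <- s) (f - (ev f)%:A)).
  elim: s => //= f s IHs; rewrite big_cons; apply: ideal_powS => //.
  by rewrite rmorphB evC subrr.
by have := prod_pow fs; rewrite size_tuple => /pow_der_in.
Qed.
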